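(* Let $a,c$ be nonzero complex numbers and let $\ell,m,n$ be nonnegative integers. Then $$ {}_4\phi_3\left[\begin{matrix}q^{-n},\,q^{1+\ell+n},\,\sqrt{qac},\,-q^{m}\sqrt{qac}\\ -q,\,q^{1+\ell+m}a,\,qc\end{matrix};q,q\right] =\frac{(q^{-n}\sqrt{qa/c},\,-q^{m-n}\sqrt{qa/c},\,q^{1+\ell+n};q)_n}{(q^{1+\ell+m}a,\,q^{-n}/c,\,-q;q)_n}\, \frac{(q^{m-n}a,\,\sqrt{qac};q)_m}{(q^{m}ac,\,q^{-n}\sqrt{qa/c};q)_m}\sum_{i=0}^{\ell}\sum_{j=0}^{m}T_{i,j}, $$ where $$ T_{i,j}=(-1)^i q^{(n+\frac52)j-ni+\binom{i+1}{2}}\Big(\frac{c}{a}\Big)^{j/2}\,\frac{1-q^{2m-2j}ac}{1-q^{2m}ac}\, \frac{(q^{-m},\,q^{-n}/c,\,q^{-2m}/(ac);q)_j}{(q,\,q^{1-2m+n}/a,\,q^{1-m}/(ac);q)_j} $$ $$ \times\frac{(q^{-\ell},\,q^{-\ell-n},\,-q^{-\ell-n},\,q^{2m-n-j}a,\,q^{j-n}/c;q)_i}{(q,\,q^{m-n}\sqrt{qa/c},\,-q^{m-n}\sqrt{qa/c},\,q^{-\ell-2n},\,q^{i-2\ell-2n-1};q)_i}\, \frac{(q^{1+2m-n+i-j}a,\,q^{1-n+i+j}/c;q^2)_{\ell+n-i}}{(q,\,q^{1+2m-2n+2i}a/c;q^2)_{\ell+n-i}}. $$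
   Context: $q$ is a nonzero complex number. For complex $x$ and an integer $n\ge 0$, the $q$-shifted factorial is $(x;q)_0=1$, $(x;q)_n=\prod_{k=0}^{n-1}(1-xq^k)$, and $(x_1,\dots,x_r;q)_n=\prod_{s=1}^r (x_s;q)_n$ (likewise with base $q^2$ in place of $q$). The basic hypergeometric series is ${}_4\phi_3\left[\begin{matrix}a_0,a_1,a_2,a_3\\ b_1,b_2,b_3\end{matrix};q,z\right]=\sum_{k\ge0}\frac{(a_0,a_1,a_2,a_3;q)_k}{(q,b_1,b_2,b_3;q)_k}z^k$. Here one upper parameter is $q^{-n}$, so the series terminates and means the sum over $0\le k\le n$. Parameters are assumed to be such that no zero factor appears in a denominator of the displayed expressions. Square roots $q^{1/2},a^{1/2},c^{1/2}$ are fixed once and for all and used multiplicatively: $\sqrt{qac}=q^{1/2}a^{1/2}c^{1/2}$, $\sqrt{qa/c}=q^{1/2}a^{1/2}/c^{1/2}$, $(c/a)^{j/2}=(c^{1/2}/a^{1/2})^j$, $q^{5j/2}=(q^{1/2})^{5j}$. *)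

(* Defs.v *)
From HB Require Import structures.
From mathcomp Require Import all_boot all_order all_algebra.
From mathcomp Require Import reals.
From mathcomp.real_closed Require Import complex.

Set Implicit Arguments.
Unset Strict Implicit.
Unset Printing Implicit Defensive.

Import GRing.Theory.
Local Open Scope ring_scope.

Section QSeries.
Variable F : fieldType.
Implicit Types (q x z a c : F).

(* (x; q)_n *)
Definition qpoch q x (n : nat) : F := \prod_(k < n) (1 - x * q ^+ k).

(* (x_1, ..., x_r; q)_n *)
Definition qpochs q (xs : seq F) (n : nat) : F := \prod_(x <- xs) qpoch q x n.

(* 4phi3 [q^-n, a1, a2, a3; b1, b2, b3; q, z]: because of the upper parameter
   q^-n the series terminates, and it means the sum over 0 <= k <= n. *)
Definition phi43 q (n : nat) (a1 a2 a3 b1 b2 b3 z : F) : F :=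
  \sum_(k < n.+1)
    qpochs q [:: q ^ (- n%:Z); a1; a2; a3] k / qpochs q [:: q; b1; b2; b3] k
    * z ^+ k.

(* The summand T_{i,j}; sq, sa, sc are the chosen square roots of q, a, c, so
   that sq * sa / sc is sqrt(q a / c), (sc / sa) ^+ j is (c / a)^(j / 2) and
   sq ^+ (5 * j) is q^(5 j / 2). *)
Definition Tsum q a c (sq sa sc : F) (l m n i j : nat) : F :=
  (-1) ^+ i * (q ^ (n%:Z * j%:Z - n%:Z * i%:Z + 'C(i.+1, 2)%:Z)
    * sq ^+ (5 * j)) * (sc / sa) ^+ j
  * ((1 - q ^ (2 * m%:Z - 2 * j%:Z) * a * c) / (1 - q ^+ (2 * m) * a * c))
  * (qpochs q [:: q ^ (- m%:Z); q ^ (- n%:Z) / c;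
                  q ^ (- (2 * m%:Z)) / (a * c)] j
     / qpochs q [:: q; q ^ (1 - 2 * m%:Z + n%:Z) / a;
                    q ^ (1 - m%:Z) / (a * c)] j)
  * (qpochs q [:: q ^ (- l%:Z); q ^ (- l%:Z - n%:Z); - q ^ (- l%:Z - n%:Z);
                  q ^ (2 * m%:Z - n%:Z - j%:Z) * a; q ^ (j%:Z - n%:Z) / c] i
     / qpochs q [:: q; q ^ (m%:Z - n%:Z) * (sq * sa / sc);
                    - q ^ (m%:Z - n%:Z) * (sq * sa / sc);
                    q ^ (- l%:Z - 2 * n%:Z);
                    q ^ (i%:Z - 2 * l%:Z - 2 * n%:Z - 1)] i)
  * (qpochs (q ^+ 2) [:: q ^ (1 + 2 * m%:Z - n%:Z + i%:Z - j%:Z) * a;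
                         q ^ (1 - n%:Z + i%:Z + j%:Z) / c] (l + n - i)
     / qpochs (q ^+ 2) [:: q; q ^ (1 + 2 * m%:Z - 2 * n%:Z + 2 * i%:Z) * a / c]
              (l + n - i)).

End QSeries.

(* Main.v *)
Require Import Defs.
From HB Require Import structures.
From mathcomp Require Import all_boot all_order all_algebra.
From mathcomp Require Import reals.
From mathcomp.real_closed Require Import complex.
From mathcomp Require Import ring zify.

Set Implicit Arguments.
Unset Strict Implicit.
Unset Printing Implicit Defensive.

Import GRing.Theory Num.Theory.
Local Open Scope ring_scope.

(** Write phi(l, m, n; a, c) for the left-hand side. It is a balanced 4phi3, and
    two three-term contiguous relations (certified term by term by telescoping)
    express phi(l+1, 0, n; a, c) through phi(l, 0, n+1; qa, c/q) and
    phi(l, 0, n; qa, c/q), and phi(l, m+1, n; a, c) through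
    phi(l, m, n; q^2 a, c) and phi(l, m, n; qa, c/q). Iterating them gives
      phi(l, m, n; a, c) = sum_j C_j phi(l, 0, n; q^(2m-j) a, q^-j c)
      phi(l, 0, n; a, c) = sum_i D_i phi(0, 0, n+l-i; q^l a, q^-l c),
    where closed forms of C_j and D_i follow from Pascal-type recurrences that
    both reduce to the two q-Pascal rules. The remaining phi(0, 0, n; a, c) is
    Andrews' q-analogue of Whipple's sum. All this needs q not to be a root of
    unity and a, c, ac, a/c not to be powers of q. This is achieved by
    perturbing the square roots over the field of rational functions in X; the
    identity is then specialised at X = 0, where the hypotheses keep the
    denominators nonzero. *)

(** * Shifted factorials and telescoping contiguous relations *)

Section Pochhammer.
Variables (F : fieldType) (q : F).
Implicit Types x u v a c f e g : F.

Lemma qpoch0 x : qpoch q x 0 = 1.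
Proof. by rewrite /qpoch big_ord0. Qed.

Lemma qpochSr x n : qpoch q x n.+1 = qpoch q x n * (1 - x * q ^+ n).
Proof. by rewrite /qpoch big_ord_recr. Qed.

Lemma qpochSl x n : qpoch q x n.+1 = (1 - x) * qpoch q (x * q) n.
Proof.
rewrite /qpoch big_ord_recl expr0 mulr1; congr (_ * _).
by apply: eq_bigr => k _; rewrite -mulrA -exprS.
Qed.

Lemma qpochD x m n :
  qpoch q x (m + n) = qpoch q x m * qpoch q (x * q ^+ m) n.
Proof.
elim: m x => [|m IHm] x; first by rewrite qpoch0 mul1r expr0 mulr1.
by rewrite addSn !qpochSl IHm -!mulrA -exprS.
Qed.

Lemma qpoch_neq0 x n :
  (forall k, (k < n)%N -> 1 - x * q ^+ k != 0) -> qpoch q x n != 0.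
Proof. by move=> h; rewrite /qpoch; apply/prodf_neq0 => k _; apply: h. Qed.

Lemma qpoch_qVn n : q != 0 -> qpoch q (q ^+ n)^-1 n.+1 = 0.
Proof. by move=> hq; rewrite qpochSr mulVf ?expf_neq0 // subrr mulr0. Qed.

Lemma qpoch_sqr x n :
  qpoch q x n * qpoch q (- x) n = qpoch (q ^+ 2) (x ^+ 2) n.
Proof.
rewrite /qpoch -big_split; apply: eq_bigr => k _ /=.
rewrite -exprM mulnC exprM; ring.
Qed.

Definition phi_term u v a b f e g k :=
  (qpoch q u k * qpoch q v k * qpoch q a k * qpoch q b k)
  / (qpoch q q k * qpoch q f k * qpoch q e k * qpoch q g k) * q ^+ k.

Definition nonpole x := forall k, 1 - x * q ^+ k != 0.

Lemma nonpole_neq0 x n : nonpole x -> qpoch q x n != 0.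
Proof. by move=> h; apply: qpoch_neq0. Qed.

Lemma nonpoleM x : nonpole x -> nonpole (x * q).
Proof. by move=> h k; rewrite -mulrA -exprS. Qed.

Lemma nonpole1 x : nonpole x -> 1 - x != 0.
Proof. by move=> h; have := h 0; rewrite expr0 mulr1. Qed.

(* With X = q^k, the k-th summand and the difference of two consecutive values
   of the right-hand side are the same multiple of a polynomial of degree 2 in
   X; kap, al and be are read off at X = 1/c, q/u and q/v. *)
Lemma contig1_sum u v a b f e c M :
  q != 0 -> u != 0 -> v != 0 -> c != 0 -> e != 0 ->
  u - v != 0 -> c - a != 0 -> c - b != 0 ->
  nonpole q -> nonpole f -> nonpole e -> nonpole c ->
  u * v * a * b = f * e * c ->
  let kap := c / ((c - a) * (c - b)) in
  let al := - kap * (1 - c) * (1 - f / u) * (1 - e / u) / (1 - v / u) in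
  let be := - kap * (1 - c) * (1 - f / v) * (1 - e / v) / (1 - u / v) in
  \sum_(k < M.+1) (phi_term u v a b f e (c * q) k
     - al * phi_term (u / q) v a b f e c k
     - be * phi_term u (v / q) a b f e c k)
  = kap * (qpoch q u M * qpoch q v M * qpoch q a M.+1 * qpoch q b M.+1)
    / (qpoch q q M * qpoch q f M * qpoch q e M * qpoch q (c * q) M).
Proof.
move=> q0 u0 v0 c0 e0 uv ca cb hq hf he hc bal kap al be.
(* The balancing condition eliminates [f]; base case and induction step then become identities of
   rational functions in independent variables. *)
have ef : f = u * v * a * b / (e * c) by rewrite bal; field; rewrite e0 c0.
have vu : v - u != 0 by rewrite -opprB oppr_eq0.
have c1 := nonpole1 hc.
elim: M => [|M IHM].
  rewrite big_ord1 /phi_term !qpochSr !qpoch0 !expr0 /al /be /kap ef; field.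
  by rewrite oner_neq0 c0 ca cb e0 u0 v0 uv vu.
rewrite big_ord_recr {}IHM /phi_term /=.
rewrite (qpochSl (u / q)) (qpochSl (v / q)) (qpochSl c) !divfK //.
rewrite !(qpochSr _ M.+1) !(qpochSr _ M) !exprS.
have nq := nonpole_neq0 M hq; have nf := nonpole_neq0 M hf.
have ne := nonpole_neq0 M he; have nc := nonpole_neq0 M (nonpoleM hc).
have := hq M; have := hf M; have := he M; have := nonpoleM hc M.
have {hf} : e * c - u * v * a * b * q ^+ M != 0.
  rewrite (_ : _ - _ = e * c * (1 - f * q ^+ M)) ?mulf_neq0 //.
  by rewrite ef; field; rewrite e0 c0.
move: nf nq ne nc; rewrite /al /be /kap.
move: (qpoch q q M) (qpoch q f M) (qpoch q e M) (qpoch q (c * q) M).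
move: (qpoch q u M) (qpoch q v M) (qpoch q a M) (qpoch q b M) (q ^+ M).
rewrite ef => X U V A B Q Fp E G nf nq ne nc h1 h2 h3 h4 h5; field.
by rewrite q0 c0 e0 u0 v0 uv vu ca cb c1 nf nq ne nc h1 h2 h3 h5.
Qed.

(** Again the sum telescopes. With X = q^k the difference of consecutive right-hand sides has the
    bracket (1-uX)(1-vX)(1-aX)(1-gX) - (1-X)(1-fX/q)(1-eX)(1-cX), which by the balancing condition
    is X times a quadratic in X. Comparison at X = 1/e and X = 1/g gives [al] and [be] in terms of
    [kap], and X = 1/a then gives [kap]. *)
Lemma contig2_sum u v a g f e c M :
  q != 0 -> a != 0 -> g != 0 -> c != 0 -> e != 0 ->
  c - a != 0 -> 1 - f / (q * a * g) != 0 -> 1 - a != 0 ->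
  nonpole q -> nonpole f -> nonpole e -> nonpole c ->
  q * u * v * a * g = f * e * c ->
  let kap := ((c - a) * (1 - f / (q * a * g)))^-1 in
  let al := - kap * e * (1 - a) * (1 - u / e) * (1 - v / e) / (1 - e) in
  let be := - kap * (1 - c) * (1 - f / (q * g)) in
  \sum_(k < M.+1) (phi_term u v a (g * q) f e (c * q) k
     - al * phi_term u v (a * q) (g * q) f (e * q) (c * q) k
     - be * phi_term u v a g f e c k)
  = kap * (qpoch q u M.+1 * qpoch q v M.+1 * qpoch q a M.+1
           * qpoch q (g * q) M)
    / (qpoch q q M * qpoch q f M * qpoch q e M.+1 * qpoch q (c * q) M).
Proof.
move=> q0 a0 g0 c0 e0 ca fqag a1 hq hf he hc bal kap al be.
have ef : f = q * u * v * a * g / (e * c).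
  by rewrite bal; field; rewrite e0 c0.
have c1 := nonpole1 hc; have e1 := nonpole1 he.
have uvec : e * c - u * v != 0.
  rewrite (_ : _ - _ = e * c * (1 - f / (q * a * g))) ?mulf_neq0 //.
  by rewrite ef; field; rewrite e0 c0 a0 g0 q0.
elim: M => [|M IHM].
  rewrite big_ord1 /phi_term !qpochSr !qpoch0 !expr0 /al /be /kap ef; field.
  by rewrite oner_neq0 c0 ca e0 e1 g0 a0 q0 uvec.
rewrite big_ord_recr {}IHM /phi_term /=.
rewrite (qpochSl g) (qpochSl c) (qpochSr a M.+1) (qpochSr e M.+1).
rewrite !(qpochSl a) !(qpochSl e) !(qpochSr _ M.+1) !(qpochSr _ M) !exprS.
have nq := nonpole_neq0 M hq; have nf := nonpole_neq0 M hf.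
have ne := nonpole_neq0 M (nonpoleM he).
have nc := nonpole_neq0 M (nonpoleM hc).
have := hq M; have := hf M; have := nonpoleM he M; have := nonpoleM hc M.
have {hf} : e * c - q * u * v * a * g * q ^+ M != 0.
  rewrite (_ : _ - _ = e * c * (1 - f * q ^+ M)) ?mulf_neq0 //.
  by rewrite ef; field; rewrite e0 c0.
move: nf nq ne nc; rewrite /al /be /kap.
move: (qpoch q q M) (qpoch q f M) (qpoch q (e * q) M) (qpoch q (c * q) M).
move: (qpoch q u M) (qpoch q v M) (qpoch q (a * q) M) (qpoch q (g * q) M).
move: (q ^+ M).
rewrite ef => X U V A B Q Fp E G nf nq ne nc h1 h2 h3 h4 h5; field.

by rewrite (mulrA e) q0 a0 g0 c0 e0 uvec ca c1 e1 nf nq ne nc h1 h2 h3 h5.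
Qed.

(* For u = q^-(n+1) and v = q^(n+2) the two series are those of n+2 and n: in
   the three-term recurrence in n the middle term drops out because the
   parameters b and -b are opposite. *)
Lemma andrews_sum u v b a c M :
  q != 0 -> u != 0 -> v != 0 -> a != 0 -> c != 0 -> 1 - u != 0 -> 1 - v != 0 ->
  u * v = q -> b ^+ 2 = q * a * c -> 1 - v * a != 0 -> 1 - v * c != 0 ->
  nonpole q -> nonpole (- q) -> nonpole (q * a) -> nonpole (q * c) ->
  let kap := (u - v) / u / ((1 - v * a) * (1 - v * c)) in
  let lam := v ^+ 2 / q * (1 - q * a / v) * (1 - q * c / v)
             / ((1 - v * a) * (1 - v * c)) in
  \sum_(k < M.+1) (phi_term (u / q) (v * q) b (- b) (- q) (q * a) (q * c) k
     - lam * phi_term (u * q) (v / q) b (- b) (- q) (q * a) (q * c) k)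
  = kap * (qpoch q u M * qpoch q v M * (qpoch q b M.+1 * qpoch q (- b) M.+1))
    / (qpoch q q M * qpoch q (- q) M * qpoch q (q * a) M * qpoch q (q * c) M).
Proof.
move=> q0 u0 v0 a0 c0 u1 v1 uv bac va vc hq hf ha hc kap lam.
have ev : v = q / u by rewrite -uv; field; rewrite u0.
have uqa : u - q * a != 0.
  by rewrite (_ : _ - _ = u * (1 - v * a)) ?mulf_neq0 // -uv; ring.
have uqc : u - q * c != 0.
  by rewrite (_ : _ - _ = u * (1 - v * c)) ?mulf_neq0 // -uv; ring.
have uq : u - q != 0.
  by rewrite (_ : _ - _ = u * (1 - v)) ?mulf_neq0 // -uv; ring.
(* The parameters [b] and [- b] occur only in paired factors, so their product removes [b] in favour
   of qac. *)
have b2 x : (1 - b * x) * (1 + b * x) = 1 - q * a * c * x ^+ 2.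
  by rewrite -bac; ring.
elim: M => [|M IHM].
  rewrite big_ord1 /phi_term !qpochSr !qpoch0 !expr0 /lam /kap mulNr opprK.
  rewrite !mul1r b2 ev; field.
  by rewrite oner_neq0 u0 uqc uqa q0.
rewrite big_ord_recr {}IHM /phi_term /=.
(* The upper parameters u/q and uq are two steps apart; all products are brought back to (u;q)_M and
   (v;q)_M, which costs a division by 1 - u and 1 - v. *)
have eU : qpoch q (u * q) M.+1 
  = qpoch q u M * (1 - u * q ^+ M) * (1 - u * q ^+ M.+1) / (1 - u).
  by rewrite -!qpochSr (qpochSl u); field.
have eV : qpoch q (v * q) M.+1 
  = qpoch q v M * (1 - v * q ^+ M) * (1 - v * q ^+ M.+1) / (1 - v).
  by rewrite -!qpochSr (qpochSl v); field.
rewrite eU eV (qpochSl (u / q)) (qpochSl (v / q)) !divfK //.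
rewrite -(mulrA _ (qpoch q b _)) -(mulrA _ (qpoch q b _)).
rewrite !(qpochSr _ M.+1) !mulNr !opprK.
rewrite (mulrACA (qpoch q b M.+1)) b2.
rewrite !(qpochSr _ M) !mulNr !opprK.
rewrite (mulrACA (qpoch q b M)) b2.
have nq := nonpole_neq0 M hq; have nf := nonpole_neq0 M hf.
have na := nonpole_neq0 M ha; have nc := nonpole_neq0 M hc.
have := hq M; have := hf M; have := ha M; have := hc M.
move: nf nq na nc; rewrite /kap /lam mulNr opprK !exprS.
move: (qpoch q q M) (qpoch q (- q) M) (qpoch q (q * a) M) (qpoch q (q * c) M).
move: (qpoch q u M) (qpoch q v M) (qpoch q b M) (qpoch q (- b) M) (q ^+ M).
rewrite ev => U V A B X Q Fp E G nf nq na nc h1 h2 h3 h4; field.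
by rewrite h1 h2 h3 h4 nf nq na nc u0 uqc uqa q0 u1 uq.
Qed.

End Pochhammer.

(** * Generic parameters *)

(** Serves the tactic below, which matches a nonvanishing condition with a hypothesis up to ring
    normalisation and sign. *)
Lemma neq0_eq (K : fieldType) (x y : K) : x != 0 -> y = x \/ y = - x -> y != 0.
Proof. by move=> x0 [->|->]; rewrite ?oppr_eq0. Qed.

Ltac nzr := repeat (apply/andP; split);
  try (assumption || exact: oner_neq0 || match goal with
  | h : is_true (_ != 0) |- _ =>
    apply: (neq0_eq h); solve [left; ring | right; ring]
  end).

Section Generic.
Variables (K : fieldType) (q : K).
Hypothesis q0 : q != 0.
Hypothesis q1 : forall k : int, k != 0 -> q ^ k != 1.
Hypothesis two0 : 1 + 1 != 0 :> K.
Implicit Types (a c x b : K) (l m n i j : nat).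

(* x is not an integral power of q. *)
Definition offq x := forall k : int, 1 - q ^ k * x != 0.

Lemma qzD (i j : int) : q ^ (i + j) = q ^ i * q ^ j. Proof. exact: expfzDr. Qed.
Lemma qzN (i : int) : q ^ (- i) = (q ^ i)^-1. Proof. by rewrite invr_expz. Qed.
Lemma qzn n : q ^ n%:Z = q ^+ n. Proof. by []. Qed.
Lemma qz_neq0 (k : int) : q ^ k != 0. Proof. exact: expfz_neq0. Qed.

Lemma qz_mulr (k k' : int) (j : nat) x :
  k + j%:Z = k' -> q ^ k * x * q ^+ j = q ^ k' * x.
Proof. by move=> <-; rewrite qzD mulrAC. Qed.

Lemma qpoch_qzS (k k' : int) x n : k + 1 = k' ->
  qpoch q (q ^ k * x) n.+1 = (1 - q ^ k * x) * qpoch q (q ^ k' * x) n.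
Proof. by move=> <-; rewrite qpochSl mulrAC qzD expr1z. Qed.

Lemma offq_shift x (k : int) : offq x -> offq (q ^ k * x).
Proof. by move=> h i; rewrite mulrA -qzD. Qed.

Lemma offqV x : x != 0 -> offq x -> offq x^-1.
Proof.
move=> x0 h k; have := h (- k); rewrite qzN => /mulf_neq0 H.
rewrite (_ : _ - _ = (1 - (q ^ k)^-1 * x) * (- q ^ k / x)).
  by apply: H; rewrite mulf_neq0 ?oppr_eq0 ?invr_eq0 ?qz_neq0.
by field; rewrite x0 qz_neq0.
Qed.

(** Passes from ac and a/c, about which the generic hypotheses speak, to the square roots b and
    b/c. *)
Lemma offq_sqr x y : x ^+ 2 = y -> offq y -> offq x.
Proof.
move=> <- h k; have := h (k + k); rewrite qzD.
by rewrite (_ : _ - _ = (1 - q ^ k * x) * (1 + q ^ k * x)) ?mulf_eq0 ?negb_or;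
  [case/andP | ring].
Qed.

(** For k nonzero, q^k = -1 would force q^(2k) = 1; for k = 0 the claim is that the characteristic
    is not 2. *)
Lemma offqN1 : offq (- 1).
Proof.
move=> k; rewrite mulrN1 opprK; have [->|k0] := eqVneq k 0.
  by rewrite expr0z.
have k20 : k + k != 0 by lia.
suff : (1 - q ^ k) * (1 + q ^ k) != 0 by rewrite mulf_eq0 negb_or => /andP[].
rewrite (_ : _ * _ = 1 - q ^ (k + k)) ?subr_eq0 1?eq_sym ?q1 //.
by rewrite qzD; ring.
Qed.

Lemma q1_nat n : 1 - q ^+ n.+1 != 0.
Proof. by rewrite subr_eq0 eq_sym; apply: (q1 (k := n.+1)). Qed.

Lemma offq_nonpole x : offq x -> nonpole q x.
Proof. by move=> h k; rewrite mulrC; apply: (h k%:Z). Qed.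

Lemma nonpole_q : nonpole q q.
Proof. by move=> k; rewrite -exprS q1_nat. Qed.

Lemma nonpole_Nq : nonpole q (- q).
Proof.
by move=> k; have := offqN1 k.+1; rewrite mulrN1 mulNr -exprS.
Qed.
Lemma qpoch_offq x n : offq x -> qpoch q x n != 0.
Proof. by move/offq_nonpole/nonpole_neq0. Qed.

(** Together with q not being a root of unity and 1 + 1 being nonzero, these conditions keep the
    denominators of the contiguous relations and of the coefficients away from zero, and they
    survive all shifts by powers of q. *)
Definition genericq a c :=
  [/\ a != 0, c != 0, offq a, offq c & offq (a * c) /\ offq (a / c)].

Lemma genericq_shift a c (i j : int) :
  genericq a c -> genericq (q ^ i * a) (q ^ j * c).
Proof.
case=> a0 c0 oa oc [oac oaDc]; have ni := qz_neq0 i; have nj := qz_neq0 j.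
split; rewrite ?mulf_neq0 //; try exact: offq_shift.
rewrite mulrACA -qzD; split; first exact: offq_shift.
by rewrite invfM mulrACA -qzN -qzD; exact: offq_shift.
Qed.

(** The root of qac is a separate argument [b], tied to [a] and [c] only by [b ^+ 2 = q * a * c], so
    the shifted series need no new choice of roots. *)
Definition phi l m n b a c :=
  phi43 q n (q ^+ (1 + l + n)) b (- q ^+ m * b)
        (- q) (q ^+ (1 + l + m) * a) (q * c) q.

(** Since (q^-n;q)_k vanishes for k > n, the sum may be prolonged; series with different n can thus
    be compared over one common range. *)
Lemma phi_termE l m n b a c M : (n <= M)%N ->
  phi l m n b a c = \sum_(k < M.+1)
    phi_term q (q ^+ n)^-1 (q ^+ (1 + l + n)) b (- q ^+ m * b)
             (- q) (q ^+ (1 + l + m) * a) (q * c) k.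
Proof.
move=> nM.
have vanish k : (n < k)%N -> qpoch q (q ^+ n)^-1 k = 0.
  by move=> nk; rewrite -(subnKC nk) qpochD qpoch_qVn // mul0r.
rewrite -(subnKC nM) -addSn big_split_ord /= addrC big1 ?add0r => [|k _].
  apply: eq_bigr => k _; rewrite /phi_term /qpochs !big_cons !big_nil.
  by rewrite !mulr1 !mulrA exprnN.
by rewrite /phi_term vanish ?mul0r // leq_addr.
Qed.

Lemma phi_sumE l m n b a c u v g e c' M : (n <= M)%N ->
  u = (q ^+ n)^-1 -> v = q ^+ (1 + l + n) -> g = - q ^+ m * b ->
  e = q ^+ (1 + l + m) * a -> c' = q * c ->
  phi l m n b a c = \sum_(k < M.+1) phi_term q u v b g (- q) e c' k.
Proof. by move=> nM -> -> -> -> ->; apply: phi_termE. Qed.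

(** This is [contig1_sum] at u = q^-n, v = q^(2+l+n): replacing u by u/q raises n, replacing v by
    v/q keeps n, and l drops in both. The lost shift in the last lower parameter is absorbed by (a,
    c) -> (qa, c/q), which leaves [b] unchanged. *)
Lemma phi_rel1 l n b a c : genericq a c -> b ^+ 2 = q * a * c ->
  let r := (1 - c^-1) / (1 - q * a / c) / (1 - q ^+ (2 + l + n + n)) in
  phi l.+1 0 n b a c =
    r * (1 + q ^+ n.+1) * (1 - q ^+ (2 + l + n) * a)
      * phi l 0 n.+1 b (q * a) (c / q)
    - r * q ^+ n.+1 * (1 + q ^+ (1 + l + n)) * (1 - a / q ^+ n)
      * phi l 0 n b (q * a) (c / q).
Proof.
move=> [a0 c0 oa oc [oac oaDc]] bac r.
have N0 : q ^+ n != 0 by rewrite expf_neq0.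
have L0 : q ^+ l != 0 by rewrite expf_neq0.
have qac : c - q * a != 0.
  have := oaDc 1; rewrite expr1z => h.
  by rewrite (_ : _ - _ = c * (1 - q * (a / c))) ?mulf_neq0 //; field.
have cb : (c - b) * (c - - b) != 0.
  rewrite (_ : _ * _ = c ^+ 2 - b ^+ 2); last by ring.
  by rewrite bac (_ : _ - _ = (c - q * a) * c) ?mulf_neq0 //; ring.
move: (cb); rewrite mulf_eq0 negb_or => /andP[cb1 cb2].
have uv1 : 1 - q ^+ (2 + l + n + n) != 0 := q1_nat (1 + l + n + n).
have uv : (q ^+ n)^-1 - q ^+ (2 + l + n) != 0.
  rewrite (_ : _ - _ = (q ^+ n)^-1 * (1 - q ^+ (2 + l + n + n))).
    by rewrite mulf_neq0 ?invr_eq0.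
  by rewrite !exprD; field.
have v0 : q ^+ (2 + l + n) != 0 by rewrite expf_neq0.
have e0 : q ^+ (2 + l) * a != 0 by rewrite mulf_neq0 ?expf_neq0.
have he : nonpole q (q ^+ (2 + l) * a).
  exact: (offq_nonpole (offq_shift (2 + l)%N oa)).
have bal : (q ^+ n)^-1 * q ^+ (2 + l + n) * b * - b
           = - q * (q ^+ (2 + l) * a) * c.
  rewrite [LHS](_ : _ = - ((q ^+ n)^-1 * q ^+ (2 + l + n)) * b ^+ 2).
    by rewrite bac !exprD; field.
  by ring.
have u0 : (q ^+ n)^-1 != 0 by rewrite invr_eq0.
have := contig1_sum n.+1 q0 u0 v0 c0 e0 uv cb1 cb2 nonpole_q nonpole_Nq he
  (offq_nonpole oc) bal.
(* The boundary term contains (q^-n;q)_(n+1) = 0, and the range up to n.+1 contains all three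
   terminating series. *)
rewrite /= qpoch_qVn // !mul0r mulr0 mul0r !sumrB -!mulr_sumr.
rewrite -(phi_sumE (l := l.+1) (m := 0) (n := n) (a := a) (c := c));
  rewrite ?addn0 ?expr0 ?mulN1r ?[c * q]mulrC ?leqnSn //.
rewrite -(phi_sumE (l := l) (m := 0) (n := n.+1) (a := q * a) (c := c / q));
  first last.
- by field.
- by rewrite addn0 !exprD; ring.
- by ring.
- by rewrite addnS.
- by rewrite exprS; field; rewrite q0 N0.
- by [].
rewrite -(phi_sumE (l := l) (m := 0) (n := n) (a := q * a) (c := c / q)); first
  last.
- by field.
- by rewrite addn0 !exprD; ring.
- by rewrite expr0; ring.
- by rewrite !exprD; field; rewrite q0.
- by [].
- by [].
move/eqP; rewrite subr_eq0 subr_eq => /eqP ->; rewrite /r.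
have -> : (c - b) * (c - - b) = c * (c - q * a).
  by rewrite [LHS](_ : _ = c ^+ 2 - b ^+ 2); [rewrite bac | ]; ring.
move: (phi l 0 n.+1 _ _ _) (phi l 0 n _ _ _) => P1 P2.
move: uv uv1; rewrite !exprD !exprS expr0 mulr1; move: N0 L0.
move: (q ^+ n) (q ^+ l) => N L N0 L0 uv uv1.
field.
rewrite N0 uv1 c0 qac oner_neq0 L0 q0 /=.
rewrite (_ : _ - _ = - (1 - q * q * L * N * N)) ?oppr_eq0 //; ring.
Qed.

(** This is [contig2_sum] with [b], - q^m b and q^(2+l+m) a in the roles of [a], [g] and [e]. The
    series with shifted [b] belongs to (q^2 a, c), the one without shifts to (qa, c/q); m drops by
    one in both. *)
Lemma phi_rel2 l m n b a c : genericq a c -> b ^+ 2 = q * a * c ->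
  let r := ((1 - b / c) * (1 - q ^+ m.+1 * a * c))^-1 in
  phi l m.+1 n b a c =
    r * (1 - b) * (1 - q ^+ (2 + l + m + n) * a) * (1 - q ^+ m.+1 * a / q ^+ n)
      / (1 - q ^+ (2 + l + m) * a) * phi l m n (b * q) (q ^+ 2 * a) c
    + r * (1 - c^-1) * (1 - q ^+ m * b) * b * phi l m n b (q * a) (c / q).
Proof.
move=> [a0 c0 oa oc [oac oaDc]] bac r.
have b0 : b != 0.
  by apply: contraNneq q0 => b0; move/eqP: bac; rewrite b0 expr0n eq_sym
   !mulf_eq0 (negPf a0) (negPf c0) !orbF.
have ob : offq b by apply: offq_sqr bac _; rewrite -mulrA; exact: offq_shift 1
  oac.
have obc : offq (b / c).
  apply: (offq_sqr (y := q * (a / c))); last exact: offq_shift 1 oaDc.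
  by rewrite expr_div_n bac; field.
have N0 : q ^+ n != 0 by rewrite expf_neq0.
have L0 : q ^+ l != 0 by rewrite expf_neq0.
have M0 : q ^+ m != 0 by rewrite expf_neq0.
have g0 : - q ^+ m * b != 0 by rewrite mulf_neq0 ?oppr_eq0.
have b1 : 1 - b != 0 by have := ob 0; rewrite expr0z mul1r.
have cb : c - b != 0.
  have := obc 0; rewrite expr0z mul1r => h.
  by rewrite (_ : _ - _ = c * (1 - b / c)) ?mulf_neq0 //; field.
have mac : 1 - q ^+ m.+1 * a * c != 0 by rewrite -mulrA; exact: (oac m.+1).
have gb : q * b * (- q ^+ m * b) = - q * q ^+ m * (q * a * c).
  by rewrite -bac; ring.
have fqag : 1 - - q / (q * b * (- q ^+ m * b)) != 0.
  rewrite gb (_ : _ - _ = - (1 - q ^+ m.+1 * a * c) / (q ^+ m.+1 * a * c)).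
    by rewrite mulf_neq0 ?oppr_eq0 ?invr_eq0 ?mulf_neq0 ?expf_neq0.
  by rewrite exprS; field; nzr.
have e0 : q ^+ (2 + l + m) * a != 0 by rewrite mulf_neq0 ?expf_neq0.
have he : nonpole q (q ^+ (2 + l + m) * a).
  exact: (offq_nonpole (offq_shift (2 + l + m)%N oa)).
have e1 := nonpole1 he.
have bal : q * (q ^+ n)^-1 * q ^+ (1 + l + n) * b * (- q ^+ m * b)
           = - q * (q ^+ (2 + l + m) * a) * c.
  rewrite [LHS](_ : _ = - (q * (q ^+ n)^-1 * q ^+ (1 + l + n) * q ^+ m) * b ^+
    2).
    by rewrite bac !exprD; field.
  by ring.
have := contig2_sum n q0 b0 g0 c0 e0 cb fqag b1 nonpole_q nonpole_Nq he
  (offq_nonpole oc) bal.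
rewrite /= qpoch_qVn // !mul0r mulr0 mul0r !sumrB -!mulr_sumr.
rewrite -(phi_sumE (l := l) (m := m.+1) (n := n) (a := a) (c := c)); first last.
- by rewrite mulrC.
- by rewrite addnS.
- by rewrite exprS; ring.
- by [].
- by [].
- by [].
rewrite -(phi_sumE (l := l) (m := m) (n := n) (a := q ^+ 2 * a) (c := c));
  first last.
- by rewrite mulrC.
- by rewrite !exprD; ring.
- by ring.
- by [].
- by [].
- by [].
rewrite -(phi_sumE (l := l) (m := m) (n := n) (a := q * a) (c := c / q)); first
  last.
- by field.
- by rewrite !exprD; ring.
- by [].
- by [].
- by [].
- by [].
move/eqP; rewrite subr_eq0 subr_eq => /eqP ->; rewrite /r.
rewrite gb; move: (phi l m n b _ _) (phi l m n (b * q) _ _) => P1 P2.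
move: mac e1; rewrite !exprD !exprS expr0 mulr1; move: M0 N0 L0.
have ea : a = b ^+ 2 / (q * c) by rewrite bac; field; rewrite q0 c0.
move: (q ^+ n) (q ^+ l) (q ^+ m) => N L M M0 N0 L0 mac e1.
rewrite ea; field.
have bm : 1 - M * b ^+ 2 != 0 by rewrite bac mulrA mulrA [M * q]mulrC.
have ce : c - q * L * M * b ^+ 2 != 0.
  rewrite (_ : _ - _ = c * (1 - q * q * L * M * a)) ?mulf_neq0 // bac; ring.
have bm' : M * b ^+ 2 - 1 != 0 by rewrite -opprB oppr_eq0.
by nzr.
Qed.

(** The product side of Andrews' sum. The factors in c are reversed, which absorbs the power
    q^(n(n+1)/2) of the usual form. *)
Definition andrews n a c :=
  qpoch (q ^+ 2) (q ^ (1 - n%:Z) * a) n * qpoch (q ^+ 2) (q ^ (1 - n%:Z) / c) n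
  / (qpoch q (q * a) n * qpoch q (q ^ (- n%:Z) / c) n).

(** Induction in steps of two: with vanishing boundary term, [andrews_sum] expresses the series for
    n+2 through that for n, and the product satisfies the same recurrence. Hence the two base cases
    0 and 1. *)
Lemma phi_andrews n b a c : genericq a c -> b ^+ 2 = q * a * c ->
  phi 0 0 n b a c = andrews n a c.
Proof.
move=> [a0 c0 oa oc [oac oaDc]] bac.
suff: phi 0 0 n b a c = andrews n a c /\ phi 0 0 n.+1 b a c = andrews n.+1 a c.
  by case.
elim: n => [|n [IH1 IH2]].
  split; rewrite (phi_termE _ _ _ _ _ (leqnn _)) /andrews.
    by rewrite big_ord1 /phi_term !qpoch0 expr0 !mulr1 !divr1.
  rewrite big_ord_recr big_ord1 /phi_term !qpochSr !qpoch0 !expr0 subrr expr0z.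
  rewrite qzN /= !expr1 !mul1r !mulr1.
  have ea : a = b ^+ 2 / (q * c) by rewrite bac; field; rewrite q0 c0.
  have qa := oa 1; have qc := oc 1; rewrite expr1z in qa qc.
  have q11 := q1_nat 0; have q12 := nonpole1 nonpole_Nq; rewrite opprK in q12.
  rewrite expr1z -[(1 + 0 + 1)%N]/2%N ea; field.
  have qc' : q * c - 1 != 0 by rewrite -opprB oppr_eq0.
  have cb : c - b ^+ 2 != 0.
    by rewrite (_ : _ - _ = c * (1 - q * a)) ?mulf_neq0 // bac; ring.
  by rewrite opprK; nzr.
split=> //.
have N0 : q ^+ n != 0 by rewrite expf_neq0.
have u0 : (q ^+ n.+1)^-1 != 0 by rewrite invr_eq0 expf_neq0.
have v0 : q ^+ n.+2 != 0 by rewrite expf_neq0.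
have u1 : 1 - (q ^+ n.+1)^-1 != 0.
  have := q1 (k := - n.+1%:Z) isT; rewrite qzN qzn => h.
  by rewrite subr_eq0 eq_sym.
have va : 1 - q ^+ n.+2 * a != 0 := oa n.+2.
have vc : 1 - q ^+ n.+2 * c != 0 := oc n.+2.
have uv : (q ^+ n.+1)^-1 * q ^+ n.+2 = q by rewrite [q ^+ n.+2]exprS mulrCA
  mulVf ?expf_neq0 ?mulr1.
have ha : nonpole q (q * a) := offq_nonpole (offq_shift 1 oa).
have hc : nonpole q (q * c) := offq_nonpole (offq_shift 1 oc).
have := andrews_sum n.+2 q0 u0 v0 a0 c0 u1 (q1_nat n.+1) uv bac va vc nonpole_q
  nonpole_Nq ha hc.
rewrite /= qpoch_qVn // !mul0r mulr0 mul0r !sumrB -!mulr_sumr.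
rewrite -(phi_sumE (l := 0) (m := 0) (n := n.+2) (a := a) (c := c)); first last.
- by [].
- by [].
- by rewrite expr0 mulN1r.
- by rewrite [RHS]exprS mulrC.
- by rewrite [in RHS]exprS invfM mulrC.
- by [].
rewrite -(phi_sumE (l := 0) (m := 0) (n := n) (a := a) (c := c)); first last.
- by [].
- by [].
- by rewrite expr0 mulN1r.
- by rewrite [in LHS]exprS mulrC mulKf.
- by rewrite exprS; field; nzr.
- by rewrite ltnW.
move/eqP; rewrite subr_eq0 IH1 => /eqP ->; rewrite /andrews.
(* In base q^2 the exponents 1-n, ..., n-1 belonging to n gain one new exponent at each end when n
   becomes n+2. *)
rewrite [in RHS](qpochSl _ (q ^ (1 - n.+2%:Z) * a)).
rewrite [in RHS](qpochSl _ (q ^ (1 - n.+2%:Z) / c)).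
rewrite (qpochSl _ (q ^ (- n.+2%:Z) / c)) (qpochSl _ (q ^ (- n.+2%:Z) / c * q)).
have -> : q ^ (1 - n.+2%:Z) * a * q ^+ 2 = q ^ (1 - n%:Z) * a.
  by apply: qz_mulr; lia.
have -> : q ^ (1 - n.+2%:Z) / c * q ^+ 2 = q ^ (1 - n%:Z) / c.
  by apply: qz_mulr; lia.
have -> : q ^ (- n.+2%:Z) / c * q * q = q ^ (- n%:Z) / c.
  by rewrite -mulrA -expr2; apply: qz_mulr; lia.
rewrite !qpochSr [q ^+ 2 ^+ n]exprAC.
have na := nonpole_neq0 n ha.
have nc : qpoch q (q ^ (- n%:Z) / c) n != 0.
  exact: qpoch_offq (offq_shift _ (offqV c0 oc)).
move: na nc va vc (oa n.+1) (oc n.+1).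
move: (qpoch q (q * a) n) (qpoch q (q ^ (- n%:Z) / c) n).
move: (qpoch (q ^+ 2) (q ^ (1 - n%:Z) * a) n).
move: (qpoch (q ^+ 2) (q ^ (1 - n%:Z) / c) n).
rewrite !(qzD, qzN, qzn, exprS, expr0); move: (q ^+ n) N0 => N N0.
rewrite mulr1 => A C E G nE nG va vc ha1 hc1; field.
by nzr.
Qed.

End Generic.

(** * Reduction of l to 0 *)

(** Lifts a Pascal-type recurrence from coefficients to sums: [x] is prolonged by its vanishing
    entry, [y] is shifted by one index. *)
Lemma pascal_sum (R : pzRingType) l (s t : R) (f x y : nat -> R) :
  x l.+1 = 0 -> f 0 = s * x 0 ->
  (forall i, (i <= l)%N -> f i.+1 = s * x i.+1 + t * y i) ->
  s * (\sum_(i < l.+1) x i) + t * (\sum_(i < l.+1) y i) = \sum_(i < l.+2) f i.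
Proof.
move=> xl f0 fS; have -> : \sum_(i < l.+1) x i = \sum_(i < l.+2) x i.
  by rewrite [RHS]big_ord_recr /= xl addr0.
rewrite [in RHS]big_ord_recl [in LHS]big_ord_recl /= f0 mulrDr -addrA.
rewrite !mulr_sumr -big_split; congr (_ + _).
by apply: eq_bigr => i _; rewrite fS // -ltnS.
Qed.

Section Generic2.
Variables (K : fieldType) (q : K).
Hypothesis q0 : q != 0.
Hypothesis q1 : forall k : int, k != 0 -> q ^ k != 1.
Implicit Types (a c x b : K) (l m n i j : nat).
Let qzD := qzD q0.
Let qzN := qzN q.
Let qzn := qzn q.

(** The Gaussian binomial coefficient. The integer exponent gives it the value 0 at j = m+1, as the
    Pascal recurrences require. *)
Definition qbin m j := qpoch q (q ^ (1 + m%:Z - j%:Z)) j / qpoch q q j.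

Lemma qbin0 m : qbin m 0 = 1.
Proof. by rewrite /qbin !qpoch0 divr1. Qed.

Lemma qbinSS m j :
  qbin m.+1 j.+1 = qbin m j * (1 - q ^+ m.+1) / (1 - q ^+ j.+1).
Proof.
rewrite /qbin !qpochSr (_ : 1 + m.+1%:Z - _ = 1 + m%:Z - j%:Z); last by lia.
rewrite -exprS -(qzn j) -qzD -(qzn m.+1).
rewrite (_ : _ + _ = m.+1%:Z :> int); last by lia.
by field; rewrite (nonpole_neq0 _ (nonpole_q q1)) q1_nat.
Qed.

Lemma qbinSr m j :
  qbin m j.+1 = qbin m j * (1 - q ^ (m%:Z - j%:Z)) / (1 - q ^+ j.+1).
Proof.
rewrite /qbin (_ : 1 + m%:Z - j.+1%:Z = m%:Z - j%:Z); last by lia.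
rewrite qpochSl -[_ * q]/(_ * q ^ 1) -qzD.
rewrite (_ : _ + 1 = 1 + m%:Z - j%:Z :> int); last by lia.
rewrite qpochSr -exprS.
by field; rewrite (nonpole_neq0 _ (nonpole_q q1)) q1_nat.
Qed.

Lemma qbin_gt m : qbin m m.+1 = 0.
Proof. by rewrite qbinSr subrr expr0z subrr mulr0 mul0r. Qed.

(* The coefficients of y^0 and y^1 are the two q-Pascal rules. *)
Lemma qbin_pascal m j y : 
  qbin m.+1 j.+1 * (1 - q ^+ m.+1 * y)
  = q ^+ j.+1 * qbin m j.+1 * (1 - q ^ (m%:Z - j%:Z) * y)
    + qbin m j * (1 - q ^ (2 * m%:Z + 1 - j%:Z) * y).
Proof.
rewrite qbinSS qbinSr (_ : 2 * m%:Z + 1 - j%:Z = m%:Z + m.+1%:Z - j%:Z); last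
  by lia.
have := q1_nat q1 j; rewrite !qzD !qzN !qzn !exprS.
move: (q ^+ m) (expf_neq0 j q0) => M; move: (q ^+ j) => J J0 hJ; field.
by nzr.
Qed.

(** The part of the coefficient D_i, below [lcoef], that involves neither a nor c. *)
Definition kcoef l i n :=
  (-1) ^+ i * q ^+ (n.+1 * i) * qbin l i * qpoch q (- q ^+ n.+1) l
  * (1 - q ^ (1 + 2 * (l%:Z + n%:Z - i%:Z)))
  / qpoch q (q ^ (1 + l%:Z + 2 * n%:Z - i%:Z)) l.+1.

Lemma qpoch_qz_neq0 (k : int) n : 0 < k -> qpoch q (q ^ k) n != 0.
Proof.
move=> k0; apply: qpoch_neq0 => i _; rewrite -(qzn i) -qzD subr_eq0 eq_sym.
by apply: q1; lia.
Qed.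

Hypothesis two0 : 1 + 1 != 0 :> K.

(** This is [qbin_pascal] at y = q^(2n+1), divided by (q^k;q)_(l+2): the two factors on its right
    are the first and the last factor of that product, the one on its left is 1 - q^(2+l+2n). The
    weight q^(i+1) arises from raising n in q^((n+1)i). *)
Lemma kcoefSS l i n : (i <= l)%N ->
  kcoef l.+1 i.+1 n =
  ((1 + q ^+ n.+1) * kcoef l i.+1 n.+1
   - q ^+ n.+1 * (1 + q ^+ (1 + l + n)) * kcoef l i n)
  / (1 - q ^+ (2 + l + n + n)).
Proof.
move=> il; rewrite /kcoef.
set k := (1 + l%:Z + 2 * n%:Z - i%:Z).
rewrite (_ : 1 + l.+1%:Z + _ - _ = k); last by rewrite /k; lia.
rewrite (_ : 1 + l%:Z + 2 * n.+1%:Z - _ = k + 1); last by rewrite /k; lia.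
rewrite (_ : l.+1%:Z + n%:Z - i.+1%:Z = l%:Z + n%:Z - i%:Z); last by lia.
rewrite (_ : l%:Z + n.+1%:Z - i.+1%:Z = l%:Z + n%:Z - i%:Z); last by lia.
have k0 : 0 < k by rewrite /k; lia.
have k10 : 0 < k + 1 by lia.
have h1 : 1 - q ^ k != 0 by have := qpoch_qz_neq0 1 k0; rewrite qpochSr qpoch0
  mul1r mulr1.
have eP1 : qpoch q (q ^ (k + 1)) l.+1 = qpoch q (q ^ k) l.+2 / (1 - q ^ k).
  by rewrite (qpochSl _ (q ^ k)) qzD expr1z [RHS]mulrAC divff // mul1r.
have eP2 : qpoch q (q ^ k) l.+2 =
    qpoch q (q ^ k) l.+1 * (1 - q ^ k * q ^+ l.+1).
  by rewrite qpochSr.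
have P0 := qpoch_qz_neq0 l.+2 k0.
have [Y0 h2] : qpoch q (q ^ k) l.+1 != 0 /\ 1 - q ^ k * q ^+ l.+1 != 0.
  by move: P0; rewrite eP2 mulf_eq0 negb_or => /andP[].
have g1 : 1 + q ^+ n.+1 != 0.
  by have := offqN1 q0 q1 two0 n.+1; rewrite mulrN1 opprK.
have g2 : 1 + q ^+ n.+1 * q ^+ l != 0.
  by have := offqN1 q0 q1 two0 (n.+1 + l)%N; rewrite mulrN1 opprK qzn exprD.
have eS1 : qpoch q (- q ^+ n.+2) l = qpoch q (- q ^+ n.+1) l.+1
    / (1 + q ^+ n.+1).
  by rewrite qpochSl opprK mulNr -exprSr [RHS]mulrAC divff // mul1r.
have eS2 : qpoch q (- q ^+ n.+1) l
    = qpoch q (- q ^+ n.+1) l.+1 / (1 + q ^+ n.+1 * q ^+ l).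
  by rewrite qpochSr mulNr opprK mulfK.
have h3 : 1 - q ^+ l.+1 * q ^+ (n + n).+1 != 0.
  by rewrite -exprD addnS q1_nat.
have := qbin_pascal l i (q ^+ (n + n).+1).
rewrite -(qzn (n + n).+1) -!qzD (_ : l%:Z - i%:Z + _ = k); last by rewrite /k;
  lia.
rewrite (_ : _ - i%:Z + _ = k + l.+1%:Z :> int); last by rewrite /k; lia.
move/(canRL (mulfK h3)) => ->.
rewrite eS1 eS2 eP1 eP2 (qzD k) (qzn l.+1).
move: (qpoch q (- q ^+ n.+1) l.+1) (1 - q ^ (1 + _)) (q ^ k) h1 h2 P0 Y0 eP2.
move=> S T X h1 h2 P0 Y0 _; move: h2 h3 g1 g2 P0; rewrite !(exprD, exprS,
  mulnS, mulSn, expr0, mulr1).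
move: (qpoch q X l.+1) Y0; move: (qbin l _) (qbin l i).
move: (q ^+ i) (q ^+ n) (q ^+ l) (q ^+ (n * i)) ((-1) ^+ i) => I N L NI E B1 B2.
move=> Y Y0 h2 h3 g1 g2 P0; field; nzr.
Qed.

Lemma kcoefS0 l n :
  kcoef l.+1 0 n =
  (1 + q ^+ n.+1) * kcoef l 0 n.+1 / (1 - q ^+ (2 + l + n + n)).
Proof.
rewrite /kcoef !qbin0 !muln0 !expr0 !mul1r.
rewrite (_ : l.+1%:Z + n%:Z - 0 = l%:Z + n.+1%:Z - 0); last by lia.
rewrite (_ : 1 + l.+1%:Z + _ - 0 = (2 + l + n + n)%N%:Z); last by lia.
rewrite (_ : 1 + l%:Z + _ - 0 = (2 + l + n + n)%N%:Z + 1); last by lia.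
rewrite (qpochSl _ (- _)) opprK mulNr -exprSr.
rewrite (qpochSl _ (q ^ (2 + l + n + n)%N)) qzD expr1z qzn.
have h1 : 1 - q ^+ (2 + l + n + n) != 0 := q1_nat q1 (1 + l + n + n).
have h2 : qpoch q (q ^ ((2 + l + n + n)%N%:Z + 1)) l.+1 != 0.
  by apply: qpoch_qz_neq0.
rewrite qzD expr1z qzn in h2; field; nzr.
Qed.

(* In lcoef and mcoef the factors (x)_(l-i), (x)_(m-j) are written as
   quotients (x)_l / (..)_i, (x)_m / (..)_j: the recurrences then hold without
   truncated subtraction, the binomial vanishing for i = l+1, j = m+1. *)
Definition lcoef l i n a c :=
  qpoch q c^-1 l * qpoch q (q ^ (1 + l%:Z + n%:Z) * a) l
    / qpoch (q ^+ 2) (q ^ 1 * (a / c)) l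
  * (qpoch q (q ^ (- n%:Z) * a) i
     / qpoch q (q ^ (1 + 2 * l%:Z + n%:Z - i%:Z) * a) i)
  * kcoef l i n.

Lemma lcoef_top l n a c : lcoef l l.+1 n a c = 0.
Proof. by rewrite /lcoef /kcoef qbin_gt mulr0 !mul0r mulr0. Qed.

Lemma qzMq (k k' : int) x : k + 1 = k' -> q ^ k * (q * x) = q ^ k' * x.
Proof. by move=> <-; rewrite qzD expr1z mulrA. Qed.

Lemma lcoef_head l n a c : c != 0 ->
  [/\ qpoch q c^-1 l.+1 = (1 - c^-1) * qpoch q (c / q)^-1 l,
      qpoch (q ^+ 2) (q ^ 1 * (a / c)) l.+1
      = (1 - q * a / c) * qpoch (q ^+ 2) (q ^ 1 * (q * a / (c / q))) l
    & qpoch q (q ^ (1 + l.+1%:Z + n%:Z) * a) l.+1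
      = (1 - q ^+ (2 + l + n) * a)
        * qpoch q (q ^ (1 + l%:Z + n.+1%:Z) * (q * a)) l].
Proof.
move=> c0; split.
- by rewrite qpochSl invfM invrK.
- rewrite qpochSl expr1z mulrA; congr (_ * qpoch _ _ _).
  by field; rewrite q0 c0.
rewrite (qpoch_qzS q0 (k' := 3 + l%:Z + n%:Z)) //; last by lia.
rewrite (qzMq (k' := 3 + l%:Z + n%:Z)); last by lia.
by rewrite -(qzn (2 + l + n)) (_ : (2 + l + n)%N%:Z = 1 + l.+1%:Z + n%:Z); last
  by lia.
Qed.

Lemma lcoefS0 l n a c : genericq q a c ->
  lcoef l.+1 0 n a c =
  (1 - c^-1) / (1 - q * a / c) / (1 - q ^+ (2 + l + n + n))
  * (1 + q ^+ n.+1) * (1 - q ^+ (2 + l + n) * a)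
  * lcoef l 0 n.+1 (q * a) (c / q).
Proof.
move=> gac; have [a0 c0 oa oc [oac oaDc]] := gac.
have [eA eB eC] := lcoef_head l n a c0.
rewrite /lcoef kcoefS0 eA eB eC !qpoch0 !invfM; ring.
Qed.

(** The factors in a and c of the three coefficients differ exactly by those which the contiguous
    relation supplies; what remains is [kcoefSS]. *)
Lemma lcoefSS l i n a c : genericq q a c -> (i <= l)%N ->
  let r := (1 - c^-1) / (1 - q * a / c) / (1 - q ^+ (2 + l + n + n)) in
  lcoef l.+1 i.+1 n a c =
    r * (1 + q ^+ n.+1) * (1 - q ^+ (2 + l + n) * a)
      * lcoef l i.+1 n.+1 (q * a) (c / q)
    - r * q ^+ n.+1 * (1 + q ^+ (1 + l + n)) * (1 - a / q ^+ n)
      * lcoef l i n (q * a) (c / q).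
Proof.
move=> gac il r; have [a0 c0 oa oc [oac oaDc]] := gac.
have [eA eB eC] := lcoef_head l n a c0.
rewrite /lcoef kcoefSS // eA eB.
set k := 2 + 2 * l%:Z + n%:Z - i%:Z.
rewrite (_ : 1 + 2 * l.+1%:Z + _ - _ = k); last by rewrite /k; lia.
rewrite (qzMq _ (k := 1 + 2 * l%:Z + n.+1%:Z - i.+1%:Z) (k' := k)); last by
  rewrite /k; lia.
rewrite (qzMq _ (k := 1 + 2 * l%:Z + n%:Z - i%:Z) (k' := k)); last by rewrite
  /k; lia.
rewrite (qzMq _ (k := - n.+1%:Z) (k' := - n%:Z)); last by lia.
rewrite (qzMq _ (k := 1 + l%:Z + n%:Z) (k' := 1 + l.+1%:Z + n%:Z)); last by lia.
set U := qpoch q (q ^ (1 + l.+1%:Z + n%:Z) * a) l.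
have kil : q ^ k * a * q ^+ i = q ^ (2 + 2 * l%:Z + n%:Z) * a.
  by apply: qz_mulr => //; rewrite /k; lia.
have h0 := offq_shift q0 (2 + 2 * l%:Z + n%:Z) oa 0; rewrite expr0z mul1r in h0.
have eU : U = (1 - q ^+ (2 + l + n) * a)
    * qpoch q (q ^ (1 + l%:Z + n.+1%:Z) * (q * a)) l
    / (1 - q ^ (2 + 2 * l%:Z + n%:Z) * a).
  rewrite -eC qpochSr (@qz_mulr _ _ q0 _ (2 + 2 * l%:Z + n%:Z)) ?mulfK //; last
    by lia.
rewrite (qpochSr _ (q ^ k * a)) kil eC eU.
rewrite (qpoch_qzS q0 (k := - n%:Z) (k' := 1 - n%:Z)); last by lia.
rewrite (qzMq _ (k := - n%:Z) (k' := 1 - n%:Z)); last by lia.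
rewrite (_ : q ^ (- n%:Z) * a = a / q ^+ n); last by rewrite qzN mulrC.
have nd := qpoch_offq i (offq_shift q0 k oa).
have h1 : 1 - q ^+ (2 + l + n + n) != 0 := q1_nat q1 (1 + l + n + n).
have h2 : 1 - q * a / c != 0.
  by have := offq_shift q0 1 oaDc 0; rewrite expr1z expr0z mul1r mulrA.
rewrite /r !invfM; ring.
Qed.

(** Induction on l. Both series in [phi_rel1] have the parameters (qa, c/q) and the same [b], so the
    two inductive expansions run over the same closed sums and combine by [pascal_sum]. *)
Lemma phi_l_expand l n b a c : genericq q a c -> b ^+ 2 = q * a * c ->
  phi q l 0 n b a c =
  \sum_(i < l.+1) lcoef l i n a c * andrews q (l + n - i) (q ^+ l * a) (c / q
    ^+ l).
Proof.
elim: l n b a c => [|l IHl] n b a c gac bac.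
  rewrite phi_andrews // big_ord1 /lcoef /kcoef qbin0 !qpoch0 subn0 add0n.
  rewrite !expr0 mul1r !divr1 muln0 qpochSr qpoch0 !expr0.
  rewrite /= !mul1r !mulr1 (_ : 1 + 2 * _ = (n + n).+1%:Z); last by lia.
  rewrite (_ : 1 + 0%:Z + _ - _ = (n + n).+1%:Z); last by lia.
  by rewrite divff ?mul1r // q1_nat.
have c0 : c != 0 by case: gac.
have gac' : genericq q (q * a) (c / q).
  have := genericq_shift q0 1 (- 1%:Z) gac.
  by rewrite qzN expr1z [X in genericq _ _ X]mulrC.
have bac' : b ^+ 2 = q * (q * a) * (c / q) by rewrite bac; field.
rewrite phi_rel1 // !IHl // -[X in _ + X = _]mulNr.
apply: (pascal_sum
  (f := fun i => lcoef l.+1 i n a c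
   * andrews q (l.+1 + n - i) (q ^+ l.+1 * a) (c / q ^+ l.+1))
  (x := fun i => lcoef l i n.+1 (q * a) (c / q)
   * andrews q (l + n.+1 - i) (q ^+ l * (q * a)) (c / q / q ^+ l))
  (y := fun i => lcoef l i n (q * a) (c / q)
   * andrews q (l + n - i) (q ^+ l * (q * a)) (c / q / q ^+ l))).
- by rewrite lcoef_top mul0r.
- have -> : q ^+ l * (q * a) = q ^+ l.+1 * a by rewrite mulrA exprSr.
  have -> : c / q / q ^+ l = c / q ^+ l.+1.
    by rewrite exprS; field; nzr; rewrite expf_neq0.
  by rewrite lcoefS0 // addnS addSn -!mulrA.
move=> i il; rewrite lcoefSS // addnS addSn !subSS.
have -> : q ^+ l * (q * a) = q ^+ l.+1 * a by rewrite mulrA exprSr.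
have -> : c / q / q ^+ l = c / q ^+ l.+1.
  by rewrite exprS; field; nzr; rewrite expf_neq0.
ring.
Qed.

End Generic2.

(** * Reduction of m to 0 *)

Section Generic3.
Variables (K : fieldType) (q : K).
Hypothesis q0 : q != 0.
Hypothesis q1 : forall k : int, k != 0 -> q ^ k != 1.
Implicit Types (a c x b : K) (l m n i j : nat).
Let qzD := qzD q0.
Let qzN := qzN q.
Let qzn := qzn q.

Lemma qzMqq (k k' : int) x : k + 2 = k' -> q ^ k * (q ^+ 2 * x) = q ^ k' * x.
Proof. by move=> <-; rewrite qzD mulrA. Qed.

(** For j <= m and nonzero denominator this is (q^k a;q)_(m-j). *)
Definition poch_quot (k : int) m j a :=
  qpoch q (q ^ k * a) m / qpoch q (q ^ (k + m%:Z - j%:Z) * a) j.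

Lemma poch_quotS (k k' : int) m j a : k' = k + 1 ->
  poch_quot k' m.+1 j a = (1 - q ^ k' * a) * poch_quot k m j (q ^+ 2 * a).
Proof.
move=> ->; rewrite /poch_quot (qpoch_qzS q0 (k' := k + 2)); last by lia.
rewrite -(qzn 2) !(mulrA _ (q ^ 2%:Z)) -!qzD mulrA.
by rewrite (_ : k + 1 + _ - _ = k + m%:Z - j%:Z + 2%:Z); last by lia.
Qed.

Lemma poch_quotSS (k k' : int) m j a : offq q a -> k' = k + 1 ->
  poch_quot k' m.+1 j.+1 a = poch_quot k m j (q * a).
Proof.
move=> oa ->; rewrite /poch_quot !(qzMq q0 _ (erefl _)).
rewrite (_ : k + 1 + _ - _ = k + m%:Z - j%:Z + 1); last by lia.
rewrite !qpochSr (qz_mulr q0 (k' := k + 1 + m%:Z)) //.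
rewrite (qz_mulr q0 (k' := k + 1 + m%:Z)); last by lia.
have h := oa (k + 1 + m%:Z).
have h2 := qpoch_offq j (offq_shift q0 (k + m%:Z - j%:Z + 1) oa).
by field; nzr.
Qed.

Definition poch_quots l m n j a :=
  poch_quot (m%:Z - n%:Z) m j a * poch_quot (1 + l%:Z + m%:Z + n%:Z) m j a
  / poch_quot (1 + l%:Z + m%:Z) m j a.

Lemma poch_quotsS l m n j a :
  poch_quots l m.+1 n j a =
  (1 - q ^+ (2 + l + m + n) * a) * (1 - q ^+ m.+1 * a / q ^+ n)
  / (1 - q ^+ (2 + l + m) * a) * poch_quots l m n j (q ^+ 2 * a).
Proof.
rewrite /poch_quots (poch_quotS (k := m%:Z - n%:Z)); last by lia.
rewrite (poch_quotS (k := 1 + l%:Z + m%:Z + n%:Z)); last by lia.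
rewrite (poch_quotS (k := 1 + l%:Z + m%:Z)); last by lia.
have -> : q ^ (m.+1%:Z - n%:Z) * a = q ^+ m.+1 * a / q ^+ n.
  by rewrite qzD qzN mulrAC.
rewrite -(qzn (2 + l + m + n)) -(qzn (2 + l + m)).
have -> : (2 + l + m + n)%N%:Z = 1 + l%:Z + m.+1%:Z + n%:Z by lia.
have -> : (2 + l + m)%N%:Z = 1 + l%:Z + m.+1%:Z by lia.
rewrite !invfM; ring.
Qed.

Lemma poch_quotsSS l m n j a : offq q a ->
  poch_quots l m.+1 n j.+1 a = poch_quots l m n j (q * a).
Proof.
move=> oa; rewrite /poch_quots (poch_quotSS (k := m%:Z - n%:Z)) //; last by lia.
rewrite (poch_quotSS (k := 1 + l%:Z + m%:Z + n%:Z)) //; last by lia.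
by rewrite (poch_quotSS (k := 1 + l%:Z + m%:Z)) //; lia.
Qed.

(** The coefficient C_j. The factor 1 - q^(2m-2j) ac is the same for all three coefficients in the
    recurrence, so that only the last factor has to obey a Pascal rule. *)
Definition mcoef l m n j b a c :=
  b ^+ j * (qpoch q b m / qpoch q (b / c) m * qpoch q c^-1 j)
  * poch_quots l m n j a * (1 - q ^ (2 * m%:Z - 2 * j%:Z) * (a * c))
  * (qbin q m j / qpoch q (q ^ (m%:Z - j%:Z) * (a * c)) m.+1).

Lemma mcoef_top l m n b a c : mcoef l m n m.+1 b a c = 0.
Proof. by rewrite /mcoef (qbin_gt q0 q1) mul0r mulr0. Qed.

(** This is [qbin_pascal] divided by (q^(m-j) y;q)_(m+2), whose first and last factors are the two
    factors on its right-hand side. *)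
Lemma mcoef_well_poised m j y : offq q y ->
  qbin q m.+1 j.+1 / qpoch q (q ^ (m%:Z - j%:Z) * y) m.+2
  = (q ^+ j.+1 * (qbin q m j.+1 / qpoch q (q ^ (m%:Z - j%:Z + 1) * y) m.+1)
     + qbin q m j / qpoch q (q ^ (m%:Z - j%:Z) * y) m.+1)
    / (1 - q ^+ m.+1 * y).
Proof.
move=> oy; have := qbin_pascal q0 q1 m j y.
have h3 : 1 - q ^+ m.+1 * y != 0 := oy m.+1.
move/(canRL (mulfK h3)) => ->.
have := qpoch_offq m.+2 (offq_shift q0 (m%:Z - j%:Z) oy).
rewrite (qpochSr _ _ m.+1) mulf_eq0 negb_or => /andP[].
have : qpoch q (q ^ (m%:Z - j%:Z) * y) m.+1 * (1 - q ^ (m%:Z - j%:Z) * y * q ^+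
  m.+1)
  = (1 - q ^ (m%:Z - j%:Z) * y) * qpoch q (q ^ (m%:Z - j%:Z + 1) * y) m.+1.
  by rewrite -qpochSr (qpoch_qzS q0 _ _ (erefl _)).
rewrite (qz_mulr q0 (k' := 2 * m%:Z + 1 - j%:Z)); last by lia.
have h4 := oy (m%:Z - j%:Z).
move/(canLR (mulKf h4)) => <- h1 h2.
field; nzr.
Qed.

Lemma generic_sqrt b a c : genericq q a c -> b ^+ 2 = q * a * c ->
  offq q b /\ offq q (b / c).
Proof.
move=> [a0 c0 oa oc [oac oaDc]] bac; split.
  by apply: (offq_sqr q0 bac); rewrite -mulrA; exact: (offq_shift q0 1 oac).
apply: (offq_sqr q0 (y := q * (a / c))); last exact: (offq_shift q0 1 oaDc).
by rewrite expr_div_n bac; field.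
Qed.

(** One form for each series in [phi_rel2]: passing to bq strips the first factor of (b;q)_(m+1),
    passing to c/q strips its last one. *)
Lemma mcoef_head m b c : c != 0 -> offq q (b / c) -> offq q b ->
  [/\ qpoch q b m.+1 / qpoch q (b / c) m.+1
      = (1 - b) / (1 - b / c) * (qpoch q (b * q) m / qpoch q (b * q / c) m)
    & qpoch q b m.+1 / qpoch q (b / c) m.+1
      = (1 - q ^+ m * b) / (1 - b / c) * (qpoch q b m / qpoch q (b / (c / q))
        m)].
Proof.
move=> c0 obc ob; split.
  by rewrite !qpochSl [b / c * q]mulrAC invfM mulrACA.
rewrite qpochSr qpochSl invfM mulrCA -mulrA (mulrC b (q ^+ m)) [RHS]mulrC.
by rewrite (_ : b / (c / q) = b / c * q); [rewrite !mulrA; ring | field; nzr].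
Qed.

Lemma mcoefS0 l m n b a c : genericq q a c -> b ^+ 2 = q * a * c ->
  let r := ((1 - b / c) * (1 - q ^+ m.+1 * a * c))^-1 in
  mcoef l m.+1 n 0 b a c =
    r * (1 - b) * (1 - q ^+ (2 + l + m + n) * a) * (1 - q ^+ m.+1 * a / q ^+ n)
      / (1 - q ^+ (2 + l + m) * a) * mcoef l m n 0 (b * q) (q ^+ 2 * a) c.
Proof.
move=> gac bac r; have [a0 c0 oa oc [oac oaDc]] := gac.
have [ob obc] := generic_sqrt gac bac.
have [eh1 eh2] := mcoef_head m c0 obc ob.
rewrite /mcoef !qbin0 !qpoch0 !expr0 !mul1r eh1.
rewrite poch_quotsS (qpoch_qzS q0 (k' := m%:Z + 2)); last by lia.
rewrite -(mulrA _ a c) !(qzMqq _ (erefl _)).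
have -> : m%:Z - 0%N%:Z + 2 = m%:Z + 2 by lia.
have -> : 2 * m%:Z - 2 * 0%N%:Z + 2 = 2 * m.+1%:Z - 2 * 0%N%:Z by lia.
have -> : m.+1%:Z - 0%N%:Z = m.+1%:Z by lia.
rewrite /r !invfM (qzn m.+1) (mulrA (q ^+ m.+1)); ring.
Qed.

(** The two summands come from the two parts of [mcoef_well_poised]; its weight q^(j+1) is absorbed
    by (bq)^(j+1). *)
Lemma mcoefSS l m n j b a c : genericq q a c -> b ^+ 2 = q * a * c ->
  let r := ((1 - b / c) * (1 - q ^+ m.+1 * a * c))^-1 in
  mcoef l m.+1 n j.+1 b a c =
    r * (1 - b) * (1 - q ^+ (2 + l + m + n) * a) * (1 - q ^+ m.+1 * a / q ^+ n)
      / (1 - q ^+ (2 + l + m) * a) * mcoef l m n j.+1 (b * q) (q ^+ 2 * a) c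
    + r * (1 - c^-1) * (1 - q ^+ m * b) * b * mcoef l m n j b (q * a) (c / q).
Proof.
move=> gac bac r; have [a0 c0 oa oc [oac oaDc]] := gac.
have [ob obc] := generic_sqrt gac bac.
have [eh1 eh2] := mcoef_head m c0 obc ob.
rewrite /mcoef (_ : m.+1%:Z - j.+1%:Z = m%:Z - j%:Z); last by lia.
rewrite (mcoef_well_poised m j oac) [in LHS]mulrA mulrDr.
have -> : q * a * (c / q) = a * c by field; nzr.
rewrite -(mulrA _ a c) !(qzMqq _ (erefl _)).
have -> : m%:Z - j.+1%:Z + 2 = m%:Z - j%:Z + 1 by lia.
have -> : 2 * m%:Z - 2 * j.+1%:Z + 2 = 2 * m.+1%:Z - 2 * j.+1%:Z by lia.
have -> : 2 * m%:Z - 2 * j%:Z = 2 * m.+1%:Z - 2 * j.+1%:Z by lia.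
rewrite mulrDl; congr (_ + _).
  by rewrite eh1 poch_quotsS exprMn /r !invfM !mulrA; ring.
rewrite eh2 poch_quotsSS //.
rewrite qpochSl exprS (_ : c^-1 * q = (c / q)^-1) ?invf_div 1?mulrC //.
by rewrite /r !invfM !mulrA; ring.
Qed.

Hypothesis two0 : 1 + 1 != 0 :> K.

Lemma phi_m_expand l m n b a c : genericq q a c -> b ^+ 2 = q * a * c ->
  phi q l m n b a c =
  \sum_(j < m.+1) mcoef l m n j b a c
    * phi q l 0 n (q ^ (m%:Z - j%:Z) * b) (q ^ (2 * m%:Z - j%:Z) * a)
        (c / q ^+ j).
Proof.
elim: m b a c => [|m IHm] b a c gac bac.
  rewrite big_ord1 subrr expr0z.
  (* At m = j = 0 the factor 1 - ac cancels against (ac;q)_1. *)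
  have -> : mcoef l 0 n 0 b a c = 1.
    have [_ _ _ _ [oac _]] := gac; have := oac 0.
    rewrite /mcoef /poch_quots /poch_quot qbin0 !qpochSr !qpoch0 !subrr !expr0z
      !expr0.
    by rewrite ?(mul1r, mulr1, divr1, invr1) => h; rewrite divff.
  by rewrite expr0 divr1 !mul1r.
have [a0 c0 _ _ _] := gac.
have gac1 : genericq q (q ^+ 2 * a) c.
  have := genericq_shift q0 2%:Z 0 gac.
  by rewrite expr0z mul1r.
have bac1 : (b * q) ^+ 2 = q * (q ^+ 2 * a) * c by rewrite exprMn bac; ring.
have gac' : genericq q (q * a) (c / q).
  have := genericq_shift q0 1 (- 1%:Z) gac.
  by rewrite qzN expr1z [X in genericq _ _ X]mulrC.
have bac' : b ^+ 2 = q * (q * a) * (c / q) by rewrite bac; field.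
rewrite (phi_rel2 q0 q1 two0) // !IHm //.
apply: (pascal_sum
  (f := fun j => mcoef l m.+1 n j b a c
    * phi q l 0 n (q ^ (m.+1%:Z - j%:Z) * b) (q ^ (2 * m.+1%:Z - j%:Z) * a)
        (c / q ^+ j))
  (x := fun j => mcoef l m n j (b * q) (q ^+ 2 * a) c
    * phi q l 0 n (q ^ (m%:Z - j%:Z) * (b * q))
       (q ^ (2 * m%:Z - j%:Z) * (q ^+ 2 * a)) (c / q ^+ j))
  (y := fun j => mcoef l m n j b (q * a) (c / q)
    * phi q l 0 n (q ^ (m%:Z - j%:Z) * b) (q ^ (2 * m%:Z - j%:Z) * (q * a))
        (c / q / q ^+ j))).
- by rewrite mcoef_top mul0r.
- rewrite mcoefS0 // ![b * q]mulrC (qzMq q0 (k' := m.+1%:Z - 0)); last by lia.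
  rewrite (qzMqq (k' := 2 * m.+1%:Z - 0)); last by lia.
  by rewrite !mulrA.
move=> j jm; rewrite mcoefSS //.
rewrite (mulrC b q) (qzMq q0 (k := m%:Z - j.+1%:Z) (k' := m.+1%:Z - j.+1%:Z));
  last by lia.
rewrite (qzMq q0 (k' := 2 * m.+1%:Z - j.+1%:Z)); last by lia.
rewrite (qzMqq (k' := 2 * m.+1%:Z - j.+1%:Z)); last by lia.
have -> : m%:Z - j%:Z = m.+1%:Z - j.+1%:Z by lia.
have -> : c / q / q ^+ j = c / q ^+ j.+1.
  by rewrite exprS; field; nzr; rewrite expf_neq0.
ring.
Qed.

End Generic3.

(** * Closed forms of the coefficients *)

Section Generic4.
Variables (K : fieldType) (q : K).
Hypothesis q0 : q != 0.
Hypothesis q1 : forall k : int, k != 0 -> q ^ k != 1.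
Implicit Types (a c x b : K) (l m n i j : nat).
Let qzD := qzD q0.
Let qzN := qzN q.
Let qzn := qzn q.

(** Reversal by 1 - y = - y (1 - 1/y) in each factor. It carries the negative powers of q in the
    stated summand to the form used in the recurrences. *)
Lemma qpoch_rev (k : int) x j : x != 0 ->
  qpoch q (q ^ k / x) j =
  (-1) ^+ j / x ^+ j * q ^ (k * j%:Z + 'C(j, 2)%:Z)
  * qpoch q (q ^ (1 - k - j%:Z) * x) j.
Proof.
move=> x0; elim: j => [|j IHj].
  by rewrite !qpoch0 bin0n mulr0 addr0 expr0z !expr0 divr1 !mulr1.
rewrite qpochSr {}IHj (qpoch_qzS q0 (k := 1 - k - j.+1%:Z) (k' := 1 - k -
  j%:Z)); last by lia.
rewrite (_ : 1 - k - j.+1%:Z = - (k + j%:Z)); last by lia.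
rewrite binS bin1.
rewrite (_ : k * j.+1%:Z + _ = (k + j%:Z) + (k * j%:Z + 'C(j, 2)%:Z)); last by
  rewrite PoszD; lia.
rewrite (mulrAC (q ^ k)) -(qzn j) -qzD (qzD (k + j%:Z)) qzN !exprS.
have h := qz_neq0 q0 (k + j%:Z).
move: (qpoch _ _ _) (q ^ (k + j%:Z)) h (q ^ (k * j%:Z + _)) => P X X0 Y.
have xj : x ^+ j != 0 by rewrite expf_neq0.
by field; nzr.
Qed.

Lemma qpoch_rev1 (k : int) j :
  qpoch q (q ^ k) j =
  (-1) ^+ j * q ^ (k * j%:Z + 'C(j, 2)%:Z) * qpoch q (q ^ (1 - k - j%:Z)) j.
Proof.
have := qpoch_rev k j (oner_neq0 K).
by rewrite expr1n !divr1 mulr1.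
Qed.

Lemma qpoch_revN1 (k : int) j :
  qpoch q (- q ^ k) j =
  q ^ (k * j%:Z + 'C(j, 2)%:Z) * qpoch q (- q ^ (1 - k - j%:Z)) j.
Proof.
have N1 : -1 != 0 :> K by rewrite oppr_eq0 oner_neq0.
have := qpoch_rev k j N1.
by rewrite invrN invr1 !mulrN1 divff ?expf_neq0 // mul1r.
Qed.

Lemma qpoch_fact k j :
  qpoch q (q ^+ k.+1) j = qpoch q q (k + j) / qpoch q q k.
Proof.
by rewrite qpochD -exprS mulrAC divff ?mul1r // (nonpole_neq0 _ (nonpole_q q1)).
Qed.

(** Separation of odd and even exponents, with (q^2;q^2)_N = (q;q)_N (-q;q)_N. *)
Lemma qpoch_double N :
  qpoch q q (N + N) = qpoch (q ^+ 2) q N * qpoch q q N * qpoch q (- q) N.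
Proof.
rewrite -mulrA qpoch_sqr; elim: N => [|N IHN]; first by rewrite !qpoch0 mulr1.
by rewrite addSn addnS !qpochSr IHN [q ^+ 2 ^+ N]exprAC !exprS exprD; ring.
Qed.

Lemma bin2_sqr i : ('C(i.+1, 2) + 'C(i, 2) = i * i)%N.
Proof.
elim: i => // i IHi; rewrite (binS i.+1) bin1.
by have := binS i 1; rewrite bin1; lia.
Qed.

Hypothesis two0 : 1 + 1 != 0 :> K.

(** After reversal of the five products with negative exponents, the products in base q become
    quotients of (q;q)_N and (-q;q)_N, and [qpoch_double] accounts for the factor in base q^2. *)
Lemma kcoefE l n i : (i <= l)%N ->
  qpoch q (q ^+ (1 + l + n)) n / qpoch q (- q) n
  * ((-1) ^+ i * q ^ (- (n%:Z * i%:Z) + 'C(i.+1, 2)%:Z)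
     * (qpoch q (q ^ (- l%:Z)) i * qpoch q (q ^ (- l%:Z - n%:Z)) i
        * qpoch q (- q ^ (- l%:Z - n%:Z)) i)
     / (qpoch q q i * qpoch q (q ^ (- l%:Z - 2 * n%:Z)) i
        * qpoch q (q ^ (i%:Z - 2 * l%:Z - 2 * n%:Z - 1)) i))
  / qpoch (q ^+ 2) q (l + n - i)
  = kcoef q l i n.
Proof.
(* Writing l = i + t removes the truncated subtraction in l + n - i. *)
move=> il; have [t -> {l il}] : exists t, l = (i + t)%N.
  by exists (l - i)%N; lia.
rewrite (_ : i + t + n - i = t + n)%N; last by lia.
rewrite /kcoef /qbin.
rewrite (_ : 1 + 2 * ((i + t)%N%:Z + n%:Z - i%:Z) = (t + n + (t + n)).+1%:Z);
  last by lia.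
rewrite (_ : 1 + (i + t)%N%:Z + 2 * n%:Z - i%:Z = (t + n + n).+1%:Z); last by
  lia.
rewrite (_ : 1 + (i + t)%N%:Z - i%:Z = t.+1%:Z); last by lia.
rewrite (qpoch_rev1 (- _)) (qpoch_rev1 (- _ - n%:Z)) (qpoch_rev1 (- _ - 2 * _)).
rewrite (qpoch_rev1 (_ - 1)) qpoch_revN1.
rewrite (_ : 1 - - (i + t)%N%:Z - i%:Z = t.+1%:Z); last by lia.
rewrite (_ : 1 - (- (i + t)%N%:Z - n%:Z) - i%:Z = (t + n).+1%:Z); last by lia.
rewrite (_ : 1 - (- (i + t)%N%:Z - 2 * n%:Z) - i%:Z = (t + n + n).+1%:Z); last
  by lia.
rewrite (_ : 1 - (_ - 1) - i%:Z = (t + n + (t + n)).+2%:Z); last by lia.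
rewrite !qzn.
have nf k : qpoch q q k != 0 := nonpole_neq0 k (nonpole_q q1).
have binii := bin2_sqr i.
(* The powers of q left by the reversals balance because the binomials of i+1 and i over 2 add up to
   i^2. *)
have hp : q ^ (- (n%:Z * i%:Z) + 'C(i.+1, 2)%:Z) =
  q ^+ (n.+1 * i)
  * q ^ ((- (i + t)%N%:Z - 2 * n%:Z) * i%:Z + 'C(i, 2)%:Z)
  * q ^ ((i%:Z - 2 * (i + t)%N%:Z - 2 * n%:Z - 1) * i%:Z + 'C(i, 2)%:Z)
  / (q ^ (- (i + t)%N%:Z * i%:Z + 'C(i, 2)%:Z)
     * q ^ ((- (i + t)%N%:Z - n%:Z) * i%:Z + 'C(i, 2)%:Z)
     * q ^ ((- (i + t)%N%:Z - n%:Z) * i%:Z + 'C(i, 2)%:Z)).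
  rewrite -!qzD -qzn -!qzD -qzN -!qzD; congr (q ^ _).
  by move: binii; lia.
rewrite hp {hp}.
rewrite (_ : 1 + (i + t) + n = (t + n + i).+1)%N; last by lia.
rewrite !qpoch_fact.
have nNq k : qpoch q (- q) k != 0 := nonpole_neq0 k (nonpole_Nq q0 q1 two0).
have -> : qpoch q (- q ^+ n.+1) (i + t)
  = qpoch q (- q) (t + n) * qpoch q (- q ^+ (t + n).+1) i / qpoch q (- q) n.
  rewrite !exprS -!mulNr -!qpochD (_ : t + n + i = n + (i + t))%N; last by lia.
  by rewrite (qpochD _ _ n) [RHS]mulrC mulKf.
rewrite (_ : t + n + i + n = t + n + n + i)%N; last by lia.
rewrite (_ : t + n + n + (i + t).+1 = (t + n + (t + n)).+1 + i)%N; last by lia.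
have := nf (t + n + (t + n))%N; have := nf (t + n + (t + n)).+1.
rewrite (qpochSr _ _ (t + n + (t + n))) qpoch_double -exprS.
rewrite !mulf_eq0 !negb_or => /andP[_ nz1] /andP[/andP[nz2 nz3] nz4].
move: (qz_neq0 q0 ((- (i + t)%N%:Z - 2 * n%:Z) * i%:Z + 'C(i, 2)%:Z)).
move: (q ^ ((- (i + t)%N%:Z - 2 * n%:Z) * i%:Z + 'C(i, 2)%:Z)) => E1 E1n.
move: (qz_neq0 q0 ((i%:Z - 2 * (i + t)%N%:Z - 2 * n%:Z - 1) * i%:Z + 'C(i,
  2)%:Z)).
move: (q ^ ((i%:Z - 2 * (i + t)%N%:Z - 2 * n%:Z - 1) * i%:Z + 'C(i, 2)%:Z)) =>
  E2 E2n.
move: (qz_neq0 q0 (- (i + t)%N%:Z * i%:Z + 'C(i, 2)%:Z)).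
move: (q ^ (- (i + t)%N%:Z * i%:Z + 'C(i, 2)%:Z)) => E3 E3n.
move: (qz_neq0 q0 ((- (i + t)%N%:Z - n%:Z) * i%:Z + 'C(i, 2)%:Z)).
move: (q ^ ((- (i + t)%N%:Z - n%:Z) * i%:Z + 'C(i, 2)%:Z)) => E4 E4n.
have := signr_eq0 K i; move/negbT.
move: ((-1) ^+ i) => s s0.
move: nz1 nz2 nz3 nz4 (nNq n) (nf (t + n + n + i)%N) (nf (t + n + i)%N) (nf t)
  (nf i)
  (nf (t + n)%N) (nf (t + n + n)%N) (nf ((t + n + (t + n)).+1 + i)%N).
move: (qpoch q q (t + n + n + i)) (qpoch q q (t + n + i)) (qpoch q q t).
move: (qpoch q q i) (qpoch q q (t + n)) (qpoch q q (t + n + n)).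
move: (qpoch q q ((t + n + (t + n)).+1 + i)) (qpoch q q (t + i)).
move: (qpoch (q ^+ 2) q (t + n)) (qpoch q (- q) (t + n)) (qpoch q (- q) n).
move: (qpoch q (- q ^+ (t + n).+1) i) (q ^+ (n.+1 * i)).
move: (q ^+ (t + n + (t + n)).+1).
move=> X1 X2 X3 X4 X5 X6 X7 X8 X9 X10 X11 X12 X13 X14.
move=> h1 h2 h3 h4 h5 h6 h7 h8 h9 h10 h11 h12.
field.

nzr.
Qed.

(** The prefactor for m = 0. The pair with parameters q^-n sqrt(qa/c) and its negative is merged
    into one product in base q^2, so no root appears. *)
Definition lead l n a c :=
  qpoch (q ^+ 2) (q ^ (1 - 2 * n%:Z) * (a / c)) n * qpoch q (q ^+ (1 + l + n)) n
  / (qpoch q (q ^+ (1 + l) * a) n * qpoch q (q ^ (- n%:Z) / c) n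
     * qpoch q (- q) n).

Definition term_i l n i a c :=
  (-1) ^+ i * q ^ (- (n%:Z * i%:Z) + 'C(i.+1, 2)%:Z)
  * (qpoch q (q ^ (- l%:Z)) i * qpoch q (q ^ (- l%:Z - n%:Z)) i
     * qpoch q (- q ^ (- l%:Z - n%:Z)) i
     * qpoch q (q ^ (- n%:Z) * a) i * qpoch q (q ^ (- n%:Z) / c) i)
  / (qpoch q q i * qpoch (q ^+ 2) (q ^ (1 - 2 * n%:Z) * (a / c)) i
     * qpoch q (q ^ (- l%:Z - 2 * n%:Z)) i
     * qpoch q (q ^ (i%:Z - 2 * l%:Z - 2 * n%:Z - 1)) i)
  * (qpoch (q ^+ 2) (q ^ (1 - n%:Z + i%:Z) * a) (l + n - i)
     * qpoch (q ^+ 2) (q ^ (1 - n%:Z + i%:Z) / c) (l + n - i))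
  / (qpoch (q ^+ 2) q (l + n - i)
     * qpoch (q ^+ 2) (q ^ (1 - 2 * n%:Z + 2 * i%:Z) * (a / c)) (l + n - i)).

Lemma qpoch_exchange (p x : K) i j m n : (i + j = m + n)%N ->
  qpoch p x i * qpoch p (x * p ^+ i) j = qpoch p x m * qpoch p (x * p ^+ m) n.
Proof. by move=> e; rewrite -!qpochD e. Qed.

Lemma qpoch_sq_offq x n : offq q x -> qpoch (q ^+ 2) x n != 0.
Proof.
by move=> ox; apply: qpoch_neq0 => k _; rewrite -exprM mulrC; apply: (ox (2 *
  k)%N).
Qed.

Lemma qpoch_qz_neg (k : int) n : k + n%:Z <= 0 -> qpoch q (q ^ k) n != 0.
Proof.
move=> kn; apply: qpoch_neq0 => i ni; rewrite -(qzn i) -qzD subr_eq0 eq_sym.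
by apply: q1; lia.
Qed.

Lemma lead_term l n i a c : genericq q a c -> (i <= l)%N ->
  lead l n a c * term_i l n i a c
  = lcoef q l i n a c * andrews q (l + n - i) (q ^+ l * a) (c / q ^+ l).
Proof.
move=> [a0 c0 oa oc [oac oaDc]] il; have l0 : q ^+ l != 0 by rewrite expf_neq0.
rewrite /lead /term_i /lcoef -kcoefE // /andrews.
set N := (l + n - i)%N.
have iN : (i + N = n + l)%N by rewrite /N; lia.
rewrite invf_div !(mulrA q) -exprS -(mulrA q a) -[q * (a / c)]/(q ^ 1 * (a /
  c)) -!(qzn l) -(qzn l.+1).
have -> : q ^ (1 - N%:Z) * (q ^ l%:Z * a) = q ^ (1 - n%:Z + i%:Z) * a.
  by rewrite mulrA -qzD; congr (q ^ _ * a); rewrite /N; lia.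
have -> : q ^ (1 - N%:Z) * (q ^ l%:Z / c) = q ^ (1 - n%:Z + i%:Z) / c.
  by rewrite mulrA -qzD; congr (q ^ _ / c); rewrite /N; lia.
have -> : q ^ (- N%:Z) * (q ^ l%:Z / c) = q ^ (i%:Z - n%:Z) / c.
  by rewrite mulrA -qzD; congr (q ^ _ / c); rewrite /N; lia.
(* Three products of l + n factors are each cut in two ways, once with pieces i and N, once with
   pieces n and l. *)
have e1 := qpoch_exchange (q ^+ 2) (q ^ (1 - 2 * n%:Z) * (a / c)) iN.
have e2 := qpoch_exchange q (q ^ (- n%:Z) / c) iN.
have Nin : (N + i = n + l)%N by rewrite addnC.
have e3 := qpoch_exchange q (q ^ l.+1%:Z * a) Nin.
move: e1 e2 e3.
rewrite -!exprM (qz_mulr q0 (k' := 1 - 2 * n%:Z + 2 * i%:Z)); last by lia.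
rewrite (qz_mulr q0 (k' := 1)); last by lia.
rewrite (qz_mulr q0 (k' := i%:Z - n%:Z)); last by lia.
rewrite (qz_mulr q0 (k' := 0)); last by lia.
rewrite (qz_mulr q0 (k' := 1 + 2 * l%:Z + n%:Z - i%:Z)); last by rewrite /N;
  lia.
rewrite (qz_mulr q0 (k' := 1 + l%:Z + n%:Z)); last by lia.
rewrite expr0z mul1r.
have n1 := qpoch_sq_offq i (offq_shift q0 (1 - 2 * n%:Z) oaDc).
have n2 := qpoch_sq_offq n (offq_shift q0 (1 - 2 * n%:Z) oaDc).
have n3 := qpoch_sq_offq l (offq_shift q0 1 oaDc).
have n4 := qpoch_offq i (offq_shift q0 (- n%:Z) (offqV q0 c0 oc)).
have n5 := qpoch_offq n (offq_shift q0 (- n%:Z) (offqV q0 c0 oc)).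
have n6 := qpoch_offq l (offqV q0 c0 oc).
have n7 := qpoch_offq n (offq_shift q0 l.+1%:Z oa).
have n8 := qpoch_offq N (offq_shift q0 l.+1%:Z oa).
have n9 := qpoch_offq l (offq_shift q0 (1 + l%:Z + n%:Z) oa).
have n10 := qpoch_offq i (offq_shift q0 (1 + 2 * l%:Z + n%:Z - i%:Z) oa).
have n11 := nonpole_neq0 i (nonpole_q q1).
have n12 := nonpole_neq0 n (nonpole_Nq q0 q1 two0).
have n13 : qpoch q (q ^ (- l%:Z - 2 * n%:Z)) i != 0.
  by apply: qpoch_qz_neg; clear -il; lia.
have n14 : qpoch q (q ^ (i%:Z - 2 * l%:Z - 2 * n%:Z - 1)) i != 0.
  by apply: qpoch_qz_neg; clear -il; lia.
have n15 : qpoch (q ^+ 2) q N != 0.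
  by apply: qpoch_neq0 => k _; rewrite -exprM -exprS q1_nat.
move/(canRL (mulKf n1)) => ->; move/(canRL (mulKf n4)) => ->.
move/(canRL (mulfK n10)) => e3; rewrite e3 in n8 *.
move: n1 n2 n3 n4 n5 n6 n7 n9 n10 n11 n12 n13 n14 n15 {n8 e3}.
move: (qpoch (q ^+ 2) (q ^ (1 - 2 * n%:Z) * (a / c)) i) => x1.
move: (qpoch (q ^+ 2) (q ^ (1 - 2 * n%:Z) * (a / c)) n) => x2.
move: (qpoch (q ^+ 2) (q ^ 1 * (a / c)) l) => x3.
move: (qpoch q (q ^ (- n%:Z) / c) i) => x4.
move: (qpoch q (q ^ (- n%:Z) / c) n) (qpoch q c^-1 l) => x5 x6.
move: (qpoch q (q ^ l.+1%:Z * a) n) => x7.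
move: (qpoch q (q ^ (1 + l%:Z + n%:Z) * a) l) => x9.
move: (qpoch q (q ^ (1 + 2 * l%:Z + n%:Z - i%:Z) * a) i) => x10.
move: (qpoch q q i) (qpoch q (- q) n) => x11 x12.
move: (qpoch q (q ^ (- l%:Z - 2 * n%:Z)) i) => x13.
move: (qpoch q (q ^ (i%:Z - 2 * l%:Z - 2 * n%:Z - 1)) i) => x14.
move: (qpoch (q ^+ 2) q N) => x15.
move: ((-1) ^+ i) (q ^ (- (n%:Z * i%:Z) + 'C(i.+1, 2)%:Z)) => s E.
move: (qpoch q (q ^ (- l%:Z)) i) (qpoch q (q ^ (- l%:Z - n%:Z)) i) => y1 y2.
move: (qpoch q (- q ^ (- l%:Z - n%:Z)) i) (qpoch q (q ^ (- n%:Z) * a) i) => y3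
  y4.
move: (qpoch (q ^+ 2) _ N) (qpoch (q ^+ 2) _ N) (qpoch q (q ^+ _) n) => y5 y6
  y7.
move=> n1 n2 n3 n4 n5 n6 n7 n9 n10 n11 n12 n13 n14 n15.
field.

nzr.
Qed.

End Generic4.

(** * The identity for generic parameters *)

Section Generic5.
Variables (K : fieldType) (q : K).
Hypothesis q0 : q != 0.
Hypothesis q1 : forall k : int, k != 0 -> q ^ k != 1.
Hypothesis two0 : 1 + 1 != 0 :> K.
Implicit Types (a c x b : K) (l m n i j : nat).
Let qzD := qzD q0.
Let qzN := qzN q.
Let qzn := qzn q.

(** Here [b / c] stands for sqrt(qa/c), since [b] is sqrt(qac). *)
Definition full_lead l m n b a c :=
  qpoch q (q ^ (- n%:Z) * (b / c)) n * qpoch q (- q ^ (m%:Z - n%:Z) * (b / c)) n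
    * qpoch q (q ^+ (1 + l + n)) n
  / (qpoch q (q ^+ (1 + l + m) * a) n * qpoch q (q ^ (- n%:Z) / c) n
     * qpoch q (- q) n)
  * (qpoch q (q ^ (m%:Z - n%:Z) * a) m * qpoch q b m
     / (qpoch q (q ^+ m * (a * c)) m * qpoch q (q ^ (- n%:Z) * (b / c)) m)).

Definition term_j m n j a c (sq sa sc : K) :=
  q ^ (n%:Z * j%:Z) * sq ^+ (5 * j) * (sc / sa) ^+ j
  * ((1 - q ^ (2 * m%:Z - 2 * j%:Z) * (a * c)) / (1 - q ^+ (2 * m) * (a * c)))
  * (qpoch q (q ^ (- m%:Z)) j * qpoch q (q ^ (- n%:Z) / c) j
     * qpoch q (q ^ (- (2 * m%:Z)) / (a * c)) j)
  / (qpoch q q j * qpoch q (q ^ (1 - 2 * m%:Z + n%:Z) / a) j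
     * qpoch q (q ^ (1 - m%:Z) / (a * c)) j).

(** The analogue of [lead_term] for j: reversals, five products cut in two ways, and the pairing of
    opposite parameters in base q^2. *)
Lemma full_lead_term l m n j a c sq sa sc :
  sq ^+ 2 = q -> sa ^+ 2 = a -> sc ^+ 2 = c -> genericq q a c ->
  full_lead l m n (sq * sa * sc) a c * term_j m n j a c sq sa sc
  = mcoef q l m n j (sq * sa * sc) a c
    * lead q l n (q ^ (2 * m%:Z - j%:Z) * a) (c / q ^+ j).
Proof.
move=> hq ha hc gac; set b := sq * sa * sc.
have bac : b ^+ 2 = q * a * c by rewrite /b -hq -ha -hc; ring.
have [ob obc] := generic_sqrt q0 gac bac.
have [a0 c0 oa oc [oac oaDc]] := gac; have ac0 : a * c != 0 by rewrite
  mulf_neq0.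
have hC : qpoch q (q ^ (m%:Z - n%:Z) * (b / c)) n
    * qpoch q (- q ^ (m%:Z - n%:Z) * (b / c)) n
    = qpoch (q ^+ 2) (q ^ (1 - 2 * n%:Z + 2 * m%:Z) * (a / c)) n.
  rewrite mulNr qpoch_sqr exprMn expr_div_n bac; congr qpoch.
  rewrite (_ : 1 - 2 * n%:Z + 2 * m%:Z = (m%:Z - n%:Z) + (m%:Z - n%:Z) + 1);
    last by lia.
  by rewrite !(qzD _ 1) (qzD (m%:Z - n%:Z)) expr1z; field.
rewrite /full_lead /term_j /mcoef /poch_quots /poch_quot /lead /qbin.
have eac : q ^ (2 * m%:Z - j%:Z) * a / (c / q ^+ j) = q ^ (2 * m%:Z) * (a / c).
  by rewrite qzD qzN qzn; field; nzr; rewrite expf_neq0.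
rewrite eac (mulrA (q ^ (1 - _))) -qzD -hC.
have -> : q ^ (- n%:Z) / (c / q ^+ j) = q ^ (j%:Z - n%:Z) / c.
  by rewrite qzD qzN !qzn; field; nzr; rewrite expf_neq0.
rewrite -(qzn (1 + l)) (mulrA (q ^ (1 + l)%N)) -qzD.
rewrite (_ : (1 + l)%N%:Z + _ = 1 + l%:Z + 2 * m%:Z - j%:Z); last by lia.
rewrite (_ : 1 + l%:Z + m%:Z + m%:Z - j%:Z = 1 + l%:Z + 2 * m%:Z - j%:Z); last
  by lia.
rewrite (_ : m%:Z - n%:Z + m%:Z - j%:Z = 2 * m%:Z - n%:Z - j%:Z); last by lia.
rewrite (_ : 1 + l%:Z + m%:Z + n%:Z + m%:Z - j%:Z = 1 + l%:Z + 2 * m%:Z + n%:Z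
  - j%:Z); last by lia.
rewrite -(qzn (1 + l + m)) (_ : (1 + l + m)%N%:Z = 1 + l%:Z + m%:Z); last by
  lia.
rewrite (qpoch_rev1 q0 (- m%:Z)) (qpoch_rev q0 (- (2 * m%:Z))) //.
rewrite (qpoch_rev q0 (1 - 2 * m%:Z + n%:Z)) // (qpoch_rev q0 (1 - m%:Z)) //.
rewrite (_ : 1 - - m%:Z - j%:Z = 1 + m%:Z - j%:Z); last by lia.
rewrite (_ : 1 - - (2 * m%:Z) - j%:Z = 2 * m%:Z - j%:Z + 1); last by lia.
rewrite (_ : 1 - (1 - 2 * m%:Z + n%:Z) - j%:Z = 2 * m%:Z - n%:Z - j%:Z); last
  by lia.
rewrite (_ : 1 - (1 - m%:Z) - j%:Z = m%:Z - j%:Z); last by lia.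
have e1 := qpoch_exchange q (q ^ (- n%:Z) * (b / c)) (addnC n m).
have e2 := qpoch_exchange q (q ^ (- n%:Z) / c) (addnC j n).
have e3 := qpoch_exchange q (q ^ (1 + l%:Z + m%:Z) * a) (addnC n m).
have e4 := qpoch_exchange q (q ^ (1 + l%:Z + 2 * m%:Z - j%:Z) * a) (addnC j n).
have e5 := qpoch_exchange q (q ^ (m%:Z - j%:Z) * (a * c)) (addnC j m.+1).
move: e1; rewrite (qz_mulr q0 (k' := 0)); last by lia.
rewrite (qz_mulr q0 (k' := m%:Z - n%:Z)) ?expr0z ?mul1r; last by lia.
move: e2; rewrite (qz_mulr q0 (k' := j%:Z - n%:Z)); last by lia.
rewrite (qz_mulr q0 (k' := 0)) ?expr0z ?mul1r; last by lia.
move: e3; rewrite (qz_mulr q0 (k' := 1 + l%:Z + m%:Z + n%:Z)); last by lia.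
rewrite (qz_mulr q0 (k' := 1 + l%:Z + 2 * m%:Z)); last by lia.
move: e4; rewrite (qz_mulr q0 (k' := 1 + l%:Z + 2 * m%:Z)); last by lia.
rewrite (qz_mulr q0 (k' := 1 + l%:Z + 2 * m%:Z + n%:Z - j%:Z)); last by lia.
move: e5; rewrite (qz_mulr q0 (k' := m%:Z)); last by lia.
rewrite (qz_mulr q0 (k' := 2 * m%:Z - j%:Z + 1)); last by lia.
rewrite (qpochSr _ (q ^ m%:Z * _)) (qz_mulr q0 (k' := (2 * m)%N%:Z)); last by
  lia.
rewrite (qzn m) (qzn (2 * m)).
have h2m : 1 - q ^+ (2 * m) * (a * c) != 0 := oac (2 * m)%N.
have n1 := qpoch_offq j (offq_shift q0 (m%:Z - j%:Z) oac).
have n2 := qpoch_offq m (offq_shift q0 m%:Z oac).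
have n3 := qpoch_offq m.+1 (offq_shift q0 (m%:Z - j%:Z) oac).
have n4 := qpoch_offq j (offq_shift q0 (1 + l%:Z + 2 * m%:Z - j%:Z) oa).
have n5 := qpoch_offq n (offq_shift q0 (1 + l%:Z + 2 * m%:Z) oa).
have n6 := qpoch_offq n (offq_shift q0 (1 + l%:Z + 2 * m%:Z - j%:Z) oa).
have n7 := qpoch_offq n (offq_shift q0 (1 + l%:Z + m%:Z) oa).
have n8 := qpoch_offq m (offq_shift q0 (1 + l%:Z + m%:Z) oa).
have n9 := qpoch_offq j (offq_shift q0 (- n%:Z) (offqV q0 c0 oc)).
have n10 := qpoch_offq n (offq_shift q0 (- n%:Z) (offqV q0 c0 oc)).
have n11 := qpoch_offq j (offqV q0 c0 oc).
have n12 := qpoch_offq m obc.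
have n13 := qpoch_offq m (offq_shift q0 (- n%:Z) obc).
have n14 := nonpole_neq0 j (nonpole_q q1).
have n15 := nonpole_neq0 n (nonpole_Nq q0 q1 two0).
have n16 := qpoch_offq j (offq_shift q0 (2 * m%:Z - n%:Z - j%:Z) oa).
rewrite (qzn m) in n2.
move/(canLR (mulKf n3)) => <-; move/(canLR (mulKf n6)) => <-.
move/(canRL (mulKf n7)) => ->; move/(canRL (mulKf n9)) => ->.
move/(canRL (mulfK n12)) => ->.
have sqr_n0 (x y : K) : x ^+ 2 = y -> y != 0 -> x ^+ j != 0.
  by move=> <-; rewrite expf_eq0 => x0; rewrite expf_neq0.
have sq0 := sqr_n0 _ _ hq q0; have sa0 := sqr_n0 _ _ ha a0.
have sc0 := sqr_n0 _ _ hc c0.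
set E1 := q ^ (- m%:Z * j%:Z + 'C(j, 2)%:Z).
set E2 := q ^ (- (2 * m%:Z) * j%:Z + 'C(j, 2)%:Z).
set E3 := q ^ ((1 - 2 * m%:Z + n%:Z) * j%:Z + 'C(j, 2)%:Z).
set E4 := q ^ ((1 - m%:Z) * j%:Z + 'C(j, 2)%:Z).
have E30 : E3 != 0 := qz_neq0 q0 _; have E40 : E4 != 0 := qz_neq0 q0 _.
have hp : q ^ (n%:Z * j%:Z) * E1 * E2 = E3 * E4 / (sq ^+ j) ^+ 4.
  have -> : (sq ^+ j) ^+ 4 = q ^ (2 * j%:Z).
    rewrite (_ : 2 * j%:Z = (2 * j)%N%:Z) // qzn -[in RHS]hq.
    rewrite -[LHS]exprM -[RHS]exprM.
    by have -> : (j * 4 = 2 * (2 * j))%N by clear; lia.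
  by rewrite /E1 /E2 /E3 /E4 -!qzD -!qzN -!qzD; congr (q ^ _); clear; lia.
(* Here the half-integral powers disappear: the reversals leave q^(-2j), which lowers 5j/2 to j/2,
   and a^j turns (c/a)^(j/2) into (ac)^(j/2), giving b^j. *)
have hb : b ^+ j = q ^ (n%:Z * j%:Z) * sq ^+ (5 * j) * (sc / sa) ^+ j
    * E1 * E2 * a ^+ j / (E3 * E4).
  have -> : sq ^+ (5 * j) = (sq ^+ j) ^+ 5 by rewrite mulnC exprM.
  have -> : a ^+ j = (sa ^+ j) ^+ 2 by rewrite -ha -!exprM mulnC.
  rewrite /b !exprMn exprVn.
  rewrite [RHS](_ : _ = q ^ (n%:Z * j%:Z) * E1 * E2 * (sq ^+ j) ^+ 5 * (sc ^+ j)
    / sa ^+ j * (sa ^+ j) ^+ 2 / (E3 * E4)); last by ring.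
  by rewrite hp; field; nzr.
rewrite hb {hb hp}.
have s0 : (-1) ^+ j != 0 :> K by rewrite signr_eq0.
have aj0 : a ^+ j != 0 by rewrite expf_neq0.
have acj0 : (a * c) ^+ j != 0 by rewrite expf_neq0.
move: (q ^ (n%:Z * j%:Z)) (sq ^+ (5 * j)) ((sc / sa) ^+ j) => p1 p2 p3.
move: s0 aj0 acj0 E30 E40 h2m n1 n2 n3 n4 n5 n6 n7 n8 n9 n10 n11 n12 n13 n14
  n15 n16.
move: ((-1) ^+ j) (a ^+ j) ((a * c) ^+ j) E1 E2 E3 E4 => s aj acj E1 E2 E3 E4.
move: (1 - q ^+ (2 * m) * (a * c)) (1 - q ^ (2 * m%:Z - 2 * j%:Z) * (a * c)) =>
  y1 y2.
move: (qpoch q (q ^ (m%:Z - j%:Z) * (a * c)) j) => x1.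
move: (qpoch q (q ^+ m * (a * c)) m) => x2.
move: (qpoch q (q ^ (m%:Z - j%:Z) * (a * c)) m.+1) => x3.
move: (qpoch q (q ^ (1 + l%:Z + 2 * m%:Z - j%:Z) * a) j) => x4.
move: (qpoch q (q ^ (1 + l%:Z + 2 * m%:Z) * a) n) => x5.
move: (qpoch q (q ^ (1 + l%:Z + 2 * m%:Z - j%:Z) * a) n) => x6.
move: (qpoch q (q ^ (1 + l%:Z + m%:Z) * a) n) => x7.
move: (qpoch q (q ^ (1 + l%:Z + m%:Z) * a) m) => x8.
move: (qpoch q (q ^ (- n%:Z) / c) j) (qpoch q (q ^ (- n%:Z) / c) n) => x9 x10.
move: (qpoch q c^-1 j) (qpoch q (b / c) m) => x11 x12.
move: (qpoch q (q ^ (- n%:Z) * (b / c)) m) (qpoch q q j) => x13 x14.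
move: (qpoch q (- q) n) (qpoch q (q ^ (2 * m%:Z - n%:Z - j%:Z) * a) j) => x15
  x16.
move: (qpoch q (q ^ (1 + m%:Z - j%:Z)) j) (qpoch q b m) => x17 x18.
move: (qpoch q (q ^ (m%:Z - n%:Z) * (b / c)) n) => x19.
move: (qpoch q (- q ^ (m%:Z - n%:Z) * (b / c)) n) => x20.
move: (qpoch q (q ^ (m%:Z - n%:Z) * a) m) (qpoch q (q ^+ (1 + l + n)) n) => x21
  x22.
move=> *.
field.

nzr.
Qed.

(** The summand decouples because i and j interact only through the shifted parameters q^(2m-j) a
    and q^-j c of the m = 0 summand. *)
Lemma Tsum_factor l m n i j a c sq sa sc :
  sq ^+ 2 = q -> sa ^+ 2 = a -> sc ^+ 2 = c -> genericq q a c ->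
  Tsum q a c sq sa sc l m n i j
  = term_j m n j a c sq sa sc
    * term_i q l n i (q ^ (2 * m%:Z - j%:Z) * a) (c / q ^+ j).
Proof.
move=> hq ha hc [a0 c0 _ _ _].
have sc0 : sc != 0 by move: c0; rewrite -hc expf_eq0.
have hB : qpoch q (q ^ (m%:Z - n%:Z) * (sq * sa / sc)) i
    * qpoch q (- q ^ (m%:Z - n%:Z) * (sq * sa / sc)) i
    = qpoch (q ^+ 2) (q ^ (1 - 2 * n%:Z + 2 * m%:Z) * (a / c)) i.
  rewrite mulNr qpoch_sqr exprMn expr_div_n exprMn hq ha hc; congr qpoch.
  rewrite (_ : 1 - 2 * n%:Z + 2 * m%:Z = (m%:Z - n%:Z) + (m%:Z - n%:Z) + 1);
    last by lia.
  by rewrite !(qzD _ 1) (qzD (m%:Z - n%:Z)) expr1z; field.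
have eac : q ^ (2 * m%:Z - j%:Z) * a / (c / q ^+ j) = q ^ (2 * m%:Z) * (a / c).
  by rewrite qzD qzN qzn; field; nzr; rewrite expf_neq0.
have ec (k : int) : q ^ k / (c / q ^+ j) = q ^ (k + j%:Z) / c.
  by rewrite qzD qzn; field; nzr; rewrite expf_neq0.
rewrite /Tsum /term_j /term_i /qpochs !big_cons !big_nil !mulr1 eac !ec.
rewrite !(mulrA (q ^ _) (q ^ (2 * m%:Z - _)) a) !(mulrA (q ^ _) (q ^ (2 *
  m%:Z)) _) -!qzD.
rewrite (mulrA (qpoch q (q ^ (m%:Z - n%:Z) * _) i)) hB.
have -> : 1 - n%:Z + i%:Z + (2 * m%:Z - j%:Z) = 1 + 2 * m%:Z - n%:Z + i%:Z -
  j%:Z by clear; lia.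
have -> : - n%:Z + (2 * m%:Z - j%:Z) = 2 * m%:Z - n%:Z - j%:Z by clear; lia.
have -> : - n%:Z + j%:Z = j%:Z - n%:Z by clear; lia.
have -> : 1 - 2 * n%:Z + 2 * i%:Z + 2 * m%:Z = 1 + 2 * m%:Z - 2 * n%:Z + 2 *
  i%:Z by clear; lia.
have -> : q ^ (n%:Z * j%:Z - n%:Z * i%:Z + 'C(i.+1, 2)%:Z)
  = q ^ (n%:Z * j%:Z) * q ^ (- (n%:Z * i%:Z) + 'C(i.+1, 2)%:Z).
  by rewrite -qzD addrA.
rewrite -!(mulrA _ a c) -(mulrA _ a c^-1) !invfM.

ring.
Qed.

(** For fixed j the series left by the reduction of m is expanded in l; the terms of the two double
    sums then agree one by one. *)
Lemma phi43_identity_generic l m n a c sq sa sc :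
  sq ^+ 2 = q -> sa ^+ 2 = a -> sc ^+ 2 = c -> genericq q a c ->
  phi43 q n (q ^+ (1 + l + n)) (sq * sa * sc) (- q ^+ m * (sq * sa * sc))
        (- q) (q ^+ (1 + l + m) * a) (q * c) q
  = (qpochs q [:: q ^ (- n%:Z) * (sq * sa / sc);
                  - q ^ (m%:Z - n%:Z) * (sq * sa / sc);
                  q ^+ (1 + l + n)] n
     / qpochs q [:: q ^+ (1 + l + m) * a; q ^ (- n%:Z) / c; - q] n)
    * (qpochs q [:: q ^ (m%:Z - n%:Z) * a; sq * sa * sc] m
       / qpochs q [:: q ^+ m * a * c; q ^ (- n%:Z) * (sq * sa / sc)] m)
    * \sum_(i < l.+1) \sum_(j < m.+1) Tsum q a c sq sa sc l m n i j.
Proof.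
move=> hq ha hc gac; set b := sq * sa * sc.
have bac : b ^+ 2 = q * a * c by rewrite /b -hq -ha -hc; ring.
have [a0 c0 _ _ _] := gac.
have sc0 : sc != 0 by move: c0; rewrite -hc expf_eq0.
rewrite [LHS](phi_m_expand q0 q1 two0 l m n gac bac).
have -> : sq * sa / sc = b / c by rewrite /b -hc; field.
rewrite [X in _ = X * _](_ : _ = full_lead l m n b a c); last first.
  by rewrite /full_lead /qpochs !big_cons !big_nil !mulr1 !mulrA.
rewrite exchange_big mulr_sumr; apply: eq_bigr => j _.
have gj : genericq q (q ^ (2 * m%:Z - j%:Z) * a) (c / q ^+ j).
  by rewrite [c / _]mulrC -(qzn j) -qzN; exact: genericq_shift.
have hj : (q ^ (m%:Z - j%:Z) * b) ^+ 2
    = q * (q ^ (2 * m%:Z - j%:Z) * a) * (c / q ^+ j).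
  rewrite exprMn bac (_ : 2 * m%:Z - j%:Z = (m%:Z - j%:Z) + (m%:Z - j%:Z) +
    j%:Z).
    by rewrite (qzD _ j%:Z) (qzD (m%:Z - j%:Z)) qzn; field; rewrite expf_neq0.
  by clear; lia.
rewrite (phi_l_expand q0 q1 two0 l n gj hj) !mulr_sumr; apply: eq_bigr => i _.
rewrite Tsum_factor // [RHS]mulrA (full_lead_term l m n j hq ha hc gac).
by rewrite -[RHS]mulrA lead_term // -ltnS.
Qed.

End Generic5.

(** * Specialisation at X = 0 *)

Section Specialisation.
Variables (F K : fieldType) (iota : {rmorphism {poly F} -> K}).
Hypothesis iota_inj : injective iota.
Implicit Types (f g : K) (u v : F) (p d : {poly F}).

(* The rational function f is regular at X = 0, with value v. *)
Definition evf f v := exists p d : {poly F},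
  [/\ d.[0] != 0, f = iota p / iota d & v = p.[0] / d.[0]].

Lemma iota_neq0 d : d.[0] != 0 -> iota d != 0.
Proof.
by apply: contraNneq => /eqP; rewrite raddf_eq0 // => /eqP ->; rewrite horner0.
Qed.

Lemma evf_poly p : evf (iota p) p.[0].
Proof. by exists p, 1; rewrite rmorph1 hornerC !divr1 oner_neq0. Qed.

(** Cross-multiplication and injectivity give an equality of polynomials, which can be evaluated at
    0. *)
Lemma evf_uniq f u v : evf f u -> evf f v -> u = v.
Proof.
move=> [p [d [d0 -> ->]]] [r [e [e0 /eqP + ->]]].
rewrite eqr_div ?iota_neq0 // -!rmorphM => /eqP /iota_inj h.
by apply/eqP; rewrite eqr_div // -!hornerM h.
Qed.

Lemma evf1 : evf 1 1.
Proof. by have := evf_poly 1; rewrite hornerC rmorph1. Qed.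

Lemma evf0 : evf 0 0.
Proof. by have := evf_poly 0; rewrite horner0 rmorph0. Qed.

Lemma evfD f g u v : evf f u -> evf g v -> evf (f + g) (u + v).
Proof.
move=> [p [d [d0 -> ->]]] [r [e [e0 -> ->]]]; exists (p * e + r * d), (d * e).
rewrite hornerM mulf_neq0 //; split=> //.
  by rewrite rmorphD !rmorphM addf_div // iota_neq0.
by rewrite hornerD !hornerM addf_div.
Qed.

Lemma evfN f u : evf f u -> evf (- f) (- u).
Proof.
by move=> [p [d [d0 -> ->]]]; exists (- p), d; rewrite rmorphN hornerN !mulNr.
Qed.

Lemma evfM f g u v : evf f u -> evf g v -> evf (f * g) (u * v).
Proof.
move=> [p [d [d0 -> ->]]] [r [e [e0 -> ->]]]; exists (p * r), (d * e).
by rewrite !hornerM mulf_neq0 // !rmorphM !mulf_div.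
Qed.

Lemma evfV f u : u != 0 -> evf f u -> evf f^-1 u^-1.
Proof.
move=> u0 [p [d [d0 -> eu]]]; exists d, p; rewrite eu !invf_div; split=> //.
by apply: contraNneq u0 => p0; rewrite eu p0 mul0r.
Qed.

Lemma evfX f u n : evf f u -> evf (f ^+ n) (u ^+ n).
Proof.
by move=> h; elim: n => [|n IHn]; [exact: evf1 | rewrite !exprS; exact: evfM].
Qed.

Lemma evfXz f u (k : int) : u != 0 -> evf f u -> evf (f ^ k) (u ^ k).
Proof.
move=> u0 h; case: k => n; first exact: evfX.
by rewrite !NegzE -!invr_expz; apply: evfV; [exact: expf_neq0 | exact: evfX].
Qed.

Lemma evf_sum n (f : 'I_n -> K) (u : 'I_n -> F) :
  (forall i, evf (f i) (u i)) -> evf (\sum_(i < n) f i) (\sum_(i < n) u i).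
Proof.
by move=> h; apply: (big_ind2 evf) => //; [exact: evf0 | move=> *; exact: evfD].
Qed.

Lemma evf_qpoch f u g v n : evf f u -> evf g v -> evf (qpoch f g n) (qpoch u v
  n).
Proof.
move=> hf hg; apply: (big_ind2 evf) => [|*|i _]; first exact: evf1.
  exact: evfM.
by apply: evfD; [exact: evf1 | apply/evfN/evfM/evfX].
Qed.

Lemma evf_qpochs0 f u n : evf (qpochs f [::] n) (qpochs u [::] n).
Proof. by rewrite /qpochs !big_nil; exact: evf1. Qed.

Lemma evf_qpochsS f u g v fs us n : evf f u -> evf g v ->
  evf (qpochs f fs n) (qpochs u us n) ->
  evf (qpochs f (g :: fs) n) (qpochs u (v :: us) n).
Proof.
by move=> hf hg h; rewrite /qpochs !big_cons; apply: evfM => //; exact: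
  evf_qpoch.
Qed.

End Specialisation.

(** Follows the structure of an expression; only the nonvanishing of denominators at X = 0 remains
    to be supplied. *)
Ltac evf := repeat first [assumption | exact: evf1 | (apply: evf_sum;
  [assumption | move=> ?]) |
  apply: evfD | apply: evfN | apply: evfM | apply: evfV | apply: evfXz |
  apply: evfX | apply: evf_qpochs0 | apply: evf_qpochsS ].

(** * Transfer from perturbed to given parameters *)

Section Transfer.
Variables (F K : fieldType) (iota : {rmorphism {poly F} -> K}).
Hypothesis iota_inj : injective iota.
Variables (q a c sq sa sc : F) (l m n : nat).
Local Notation evf := (evf iota).
Hypotheses (hq : q != 0) (ha : a != 0) (hc : c != 0) (hsc : sc != 0) (hsa : sa
  != 0).
Hypothesis hphi : forall k : nat, (k <= n)%N ->
    qpochs q [:: q; - q; q ^+ (1 + l + m) * a; q * c] k != 0.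
Hypothesis hpre1 :
  qpochs q [:: q ^+ (1 + l + m) * a; q ^ (- n%:Z) / c; - q] n != 0.
Hypothesis hpre2 :
  qpochs q [:: q ^+ m * a * c; q ^ (- n%:Z) * (sq * sa / sc)] m != 0.
Hypothesis hT1 : 1 - q ^+ (2 * m) * a * c != 0.
Hypothesis hT2 : forall j : nat, (j <= m)%N ->
    qpochs q [:: q; q ^ (1 - 2 * m%:Z + n%:Z) / a;
                 q ^ (1 - m%:Z) / (a * c)] j != 0.
Hypothesis hT3 : forall i : nat, (i <= l)%N ->
    qpochs q [:: q; q ^ (m%:Z - n%:Z) * (sq * sa / sc);
                 - q ^ (m%:Z - n%:Z) * (sq * sa / sc);
                 q ^ (- l%:Z - 2 * n%:Z);
                 q ^ (i%:Z - 2 * l%:Z - 2 * n%:Z - 1)] i != 0.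
Hypothesis hT4 : forall i : nat, (i <= l)%N ->
    qpochs (q ^+ 2) [:: q; q ^ (1 + 2 * m%:Z - 2 * n%:Z + 2 * i%:Z) * a / c]
           (l + n - i) != 0.
Variables (fq fa fc fsq fsa fsc : K).
Hypotheses (eq : evf fq q) (ea : evf fa a) (ec : evf fc c)
  (esq : evf fsq sq) (esa : evf fsa sa) (esc : evf fsc sc).

Lemma evf_phi :
  evf (phi43 fq n (fq ^+ (1 + l + n)) (fsq * fsa * fsc) (- fq ^+ m * (fsq * fsa
    * fsc))
        (- fq) (fq ^+ (1 + l + m) * fa) (fq * fc) fq)
   (phi43 q n (q ^+ (1 + l + n)) (sq * sa * sc) (- q ^+ m * (sq * sa * sc))
        (- q) (q ^+ (1 + l + m) * a) (q * c) q).
Proof. by rewrite /phi43; evf; apply: hphi; rewrite -ltnS. Qed.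

Lemma evf_Tsum i j : (i <= l)%N -> (j <= m)%N ->
  evf (Tsum fq fa fc fsq fsa fsc l m n i j) (Tsum q a c sq sa sc l m n i j).
Proof.
move=> il jm; have ac := mulf_neq0 ha hc.
have h2 := hT2 jm; have h3 := hT3 il; have h4 := hT4 il.
rewrite /Tsum; evf.
Qed.

Lemma specialise_identity :
  phi43 fq n (fq ^+ (1 + l + n)) (fsq * fsa * fsc)
    (- fq ^+ m * (fsq * fsa * fsc)) (- fq) (fq ^+ (1 + l + m) * fa) (fq * fc) fq
  = (qpochs fq [:: fq ^ (- n%:Z) * (fsq * fsa / fsc);
                  - fq ^ (m%:Z - n%:Z) * (fsq * fsa / fsc);
                  fq ^+ (1 + l + n)] n
     / qpochs fq [:: fq ^+ (1 + l + m) * fa; fq ^ (- n%:Z) / fc; - fq] n)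
    * (qpochs fq [:: fq ^ (m%:Z - n%:Z) * fa; fsq * fsa * fsc] m
       / qpochs fq [:: fq ^+ m * fa * fc; fq ^ (- n%:Z) * (fsq * fsa / fsc)] m)
    * \sum_(i < l.+1) \sum_(j < m.+1) Tsum fq fa fc fsq fsa fsc l m n i j ->
  phi43 q n (q ^+ (1 + l + n)) (sq * sa * sc)
    (- q ^+ m * (sq * sa * sc)) (- q) (q ^+ (1 + l + m) * a) (q * c) q
  = (qpochs q [:: q ^ (- n%:Z) * (sq * sa / sc);
                  - q ^ (m%:Z - n%:Z) * (sq * sa / sc);
                  q ^+ (1 + l + n)] n
     / qpochs q [:: q ^+ (1 + l + m) * a; q ^ (- n%:Z) / c; - q] n)
    * (qpochs q [:: q ^ (m%:Z - n%:Z) * a; sq * sa * sc] m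
       / qpochs q [:: q ^+ m * a * c; q ^ (- n%:Z) * (sq * sa / sc)] m)
    * \sum_(i < l.+1) \sum_(j < m.+1) Tsum q a c sq sa sc l m n i j.
Proof.
move=> e; apply: (evf_uniq iota_inj evf_phi); rewrite e.
apply: evfM => //; first by evf.
do 2 apply: evf_sum => // ?; by apply: evf_Tsum; rewrite -ltnS.
Qed.

End Transfer.

(** * Perturbations that are generic *)

Section Perturbation.
Variables (F K : fieldType) (iota : {rmorphism {poly F} -> K}).
Hypothesis iota_inj : injective iota.
Implicit Types (p s u : {poly F}) (r : F).

Lemma iota_neq0_at p r : p.[r] != 0 -> iota p != 0.
Proof.
by apply: contraNneq => /eqP; rewrite raddf_eq0 // => /eqP ->; rewrite horner0.
Qed.

(** If u^k p / s were 1, clearing denominators and evaluating at r would equate 0 with a product of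
    nonzero values. *)
Lemma offq_root u p s r : u.[r] != 0 -> s.[r] != 0 -> p.[r] = 0 ->
  offq (iota u) (iota p / iota s).
Proof.
move=> ur sr pr k; rewrite subr_eq0 eq_sym; apply/eqP => e.
have uF := iota_neq0_at ur; have sF := iota_neq0_at sr.
case: k e => n e.
  have /iota_inj ep : iota (u ^+ n * p) = iota s.
    by rewrite rmorphM rmorphXn -[RHS]mul1r -e mulrA divfK.
  by move: sr; rewrite -ep hornerM pr mulr0 eqxx.
have /iota_inj ep : iota p = iota (u ^+ n.+1 * s).
  rewrite rmorphM rmorphXn -[RHS]mulr1 -e NegzE -invr_expz -exprnP.
  by field; rewrite sF expf_neq0.
move: pr; rewrite ep hornerM horner_exp => /eqP.
by rewrite mulf_eq0 expf_eq0 (negPf ur) (negPf sr).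
Qed.

(** If a positive power of u were 1, evaluation at r would give 0 = 1; negative exponents follow by
    inversion. *)
Lemma expz_root u r : u.[r] = 0 -> forall k : int, k != 0 -> iota u ^ k != 1.
Proof.
move=> ur.
have pos n : iota u ^+ n.+1 != 1.
  rewrite -rmorphXn -(rmorph1 iota) (inj_eq iota_inj); apply/eqP => e.
  have := congr1 (horner^~ r) e; rewrite horner_exp ur expr0n hornerC => /eqP.
  by rewrite eq_sym oner_eq0.
case=> [[//|n]|n] _; first exact: pos.
by rewrite NegzE -invr_expz invr_eq1; exact: pos.
Qed.

End Perturbation.

Lemma exists_generic_perturbation (F : numFieldType) (K : fieldType)
  (iota : {rmorphism {poly F} -> K}) (sq sa sc : F) : injective iota ->
  sq != 0 -> sa != 0 -> sc != 0 ->
  exists fq fa fc : K, 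
    [/\ evf iota fq sq, evf iota fa sa, evf iota fc sc,
        forall k : int, k != 0 -> (fq ^+ 2) ^ k != 1
      & genericq (fq ^+ 2) (fa ^+ 2) (fc ^+ 2)].
Proof.
move=> inj sq0 sa0 sc0.
(* The roots -1, 1 and -1/2 are distinct, and each polynomial has the prescribed value at 0. The
   root -1 shows that q is not a root of unity, the root 1 serves a, ac and a/c, and the root -1/2
   serves c. *)
pose pq := sq *: (1 + 'X); pose pa := sa *: (1 - 'X).
pose pc := sc *: (1 + 2 *: 'X).
have pqE x : pq.[x] = sq * (1 + x) by rewrite !hornerE.
have paE x : pa.[x] = sa * (1 - x) by rewrite !hornerE.
have pcE x : pc.[x] = sc * (1 + 2 * x) by rewrite !hornerE.
exists (iota pq), (iota pa), (iota pc); split.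
- by have := evf_poly iota pq; rewrite pqE addr0 mulr1.
- by have := evf_poly iota pa; rewrite paE subr0 mulr1.
- by have := evf_poly iota pc; rewrite pcE mulr0 addr0 mulr1.
- rewrite -rmorphXn; apply: (expz_root inj (r := -1)).
  by rewrite horner_exp pqE subrr mulr0 expr0n.
rewrite -!rmorphXn.
have q_1 : (pq ^+ 2).[1] != 0.
  by rewrite horner_exp pqE expf_neq0 // mulf_neq0 // -(natrD _ 1 1) pnatr_eq0.
have c_1 : (pc ^+ 2).[1] != 0.
  by rewrite horner_exp pcE expf_neq0 // mulf_neq0 // mulr1 -(natrD _ 1 2)
    pnatr_eq0.
have a_1 : (pa ^+ 2).[1] = 0 by rewrite horner_exp paE subrr mulr0 expr0n.
have q_2 : (pq ^+ 2).[- 2^-1] != 0.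
  rewrite horner_exp pqE expf_neq0 // mulf_neq0 //.
  by rewrite (_ : 1 - _ = 2^-1) ?invr_eq0 ?pnatr_eq0 //; field.
have c_2 : (pc ^+ 2).[- 2^-1] = 0.
  by rewrite horner_exp pcE (_ : 1 + _ = 0) ?mulr0 ?expr0n //; field.
have a_2 : (pa ^+ 2).[- 2^-1] != 0.
  rewrite horner_exp paE expf_neq0 // mulf_neq0 //.
  by rewrite (_ : 1 - _ = 3 / 2) ?mulf_neq0 ?invr_eq0 ?pnatr_eq0 //; field.
have one_1 x : (1 : {poly F}).[x] != 0 by rewrite hornerC oner_neq0.
have ac_1 : (pa ^+ 2 * pc ^+ 2).[1] = 0 by rewrite hornerM a_1 mul0r.
split.
- exact: iota_neq0_at a_2.
- exact: iota_neq0_at c_1.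
- by have := offq_root inj q_1 (one_1 _) a_1; rewrite rmorph1 divr1.
- by have := offq_root inj q_2 (one_1 _) c_2; rewrite rmorph1 divr1.
split; last exact: offq_root q_1 c_1 a_1.
by rewrite -rmorphM; have := offq_root inj q_1 (one_1 _) ac_1; rewrite rmorph1
  divr1.
Qed.

Theorem mainTheorem11 (R : realType) (q a c sq sa sc : complex R)
  (l m n : nat)
  (hq : q != 0) (ha : a != 0) (hc : c != 0)
  (hsq : sq ^+ 2 = q) (hsa : sa ^+ 2 = a) (hsc : sc ^+ 2 = c)
  (hphi : forall k : nat, (k <= n)%N ->
    qpochs q [:: q; - q; q ^+ (1 + l + m) * a; q * c] k != 0)
  (hpre1 : qpochs q [:: q ^+ (1 + l + m) * a; q ^ (- n%:Z) / c; - q] n != 0)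
  (hpre2 : qpochs q [:: q ^+ m * a * c; q ^ (- n%:Z) * (sq * sa / sc)] m != 0)
  (hT1 : 1 - q ^+ (2 * m) * a * c != 0)
  (hT2 : forall j : nat, (j <= m)%N ->
    qpochs q [:: q; q ^ (1 - 2 * m%:Z + n%:Z) / a;
                 q ^ (1 - m%:Z) / (a * c)] j != 0)
  (hT3 : forall i : nat, (i <= l)%N ->
    qpochs q [:: q; q ^ (m%:Z - n%:Z) * (sq * sa / sc);
                 - q ^ (m%:Z - n%:Z) * (sq * sa / sc);
                 q ^ (- l%:Z - 2 * n%:Z);
                 q ^ (i%:Z - 2 * l%:Z - 2 * n%:Z - 1)] i != 0)
  (hT4 : forall i : nat, (i <= l)%N ->
    qpochs (q ^+ 2) [:: q; q ^ (1 + 2 * m%:Z - 2 * n%:Z + 2 * i%:Z) * a / c]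
           (l + n - i) != 0) :
  phi43 q n (q ^+ (1 + l + n)) (sq * sa * sc) (- q ^+ m * (sq * sa * sc))
        (- q) (q ^+ (1 + l + m) * a) (q * c) q
  = (qpochs q [:: q ^ (- n%:Z) * (sq * sa / sc);
                  - q ^ (m%:Z - n%:Z) * (sq * sa / sc);
                  q ^+ (1 + l + n)] n
     / qpochs q [:: q ^+ (1 + l + m) * a; q ^ (- n%:Z) / c; - q] n)
    * (qpochs q [:: q ^ (m%:Z - n%:Z) * a; sq * sa * sc] m
       / qpochs q [:: q ^+ m * a * c; q ^ (- n%:Z) * (sq * sa / sc)] m)
    * \sum_(i < l.+1) \sum_(j < m.+1) Tsum q a c sq sa sc l m n i j.
Proof.
have [sq0 sa0 sc0] : [/\ sq != 0, sa != 0 & sc != 0].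
  by move: hq ha hc; rewrite -hsq -hsa -hsc !expf_eq0.
pose K : fieldType := {fraction {poly complex R}}.
pose iota : {rmorphism {poly complex R} -> K} := @FracField.tofrac _.
have inj : injective iota by move=> x y /eqP; rewrite tofrac_eq => /eqP.
(* From here on only a field with an injective morphism from the polynomials matters. *)
move: K iota inj => K iota inj.
have [fq [fa [fc [eq ea ec q1 gen]]]] := exists_generic_perturbation inj sq0
  sa0 sc0.
(* Both facts are pulled back from X = 0, where the values are q and 2. *)
have [fq0 two0] : fq ^+ 2 != 0 /\ 1 + 1 != 0 :> K.
  split; apply/eqP => e.
    move/eqP: hq; apply; rewrite -hsq.
    by apply: (evf_uniq inj (evfX 2 eq)); rewrite e; exact: evf0.
  have := evf_uniq inj (evfD inj (evf1 iota) (evf1 iota)).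
  by rewrite e => /(_ 0 (evf0 iota)) /eqP; rewrite -(natrD _ 1 1) pnatr_eq0.
(* The perturbed parameters are squares by construction, so their roots are at hand. *)
have := phi43_identity_generic fq0 q1 two0 l m n (erefl _) (erefl _) (erefl _)
  gen.
have eqq : evf iota (fq ^+ 2) q by rewrite -hsq; exact: evfX.
have eaa : evf iota (fa ^+ 2) a by rewrite -hsa; exact: evfX.
have ecc : evf iota (fc ^+ 2) c by rewrite -hsc; exact: evfX.
exact: (specialise_identity inj).
Qed.
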